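(* Let $\Lambda=\Lambda_{(\phi,\psi)}=\begin{pmatrix} A & {}_AN_B \\ {}_BM_A & B\end{pmatrix}$ be a Morita ring, and let $(\mathcal{U},\mathcal{X})$ and $(\mathcal{V},\mathcal{Y})$ be cotorsion pairs in $A\text{-}\mathrm{Mod}$ and $B\text{-}\mathrm{Mod}$, respectively. Assume that $N\otimes_BM=0$. Define the following classes of left $\Lambda$-modules: $$\mathcal{M}^{\mathcal{U}}_{\mathcal{V}}=\Big\{\begin{pmatrix} X \\ Y \end{pmatrix}_{f,g}\ \Big|\ \operatorname{Coker} g\in\mathcal{U},\ Y\in\mathcal{V},\ g\text{ is a monomorphism}\Big\},$$ $$\mathcal{N}^{\mathcal{X}}_{\mathcal{Y}}=\Big\{\begin{pmatrix} X \\ Y \end{pmatrix}_{f,g}\ \Big|\ \operatorname{Ker}\tilde f\in\mathcal{X},\ Y\in\mathcal{Y},\ \tilde f\text{ is an epimorphism}\Big\}.$$ (1) If $\operatorname{Tor}^B_1(N,\mathcal{V})=0$, then $({}^\perp\mathcal{N}^{\mathcal{X}}_{\mathcal{Y}},\mathcal{N}^{\mathcal{X}}_{\mathcal{Y}})$ is a cotorsion pair in $\Lambda\text{-}\mathrm{Mod}$; if $\operatorname{Ext}_B^1(M,\mathcal{Y})=0$, then $(\mathcal{M}^{\mathcal{U}}_{\mathcal{V}},(\mathcal{M}^{\mathcal{U}}_{\mathcal{V}})^\perp)$ is a cotorsion pair in $\Lambda\text{-}\mathrm{Mod}$. (2) If $\operatorname{Tor}^B_1(N,\mathcal{V})=0$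 and $\operatorname{Ext}_B^1(M,\mathcal{Y})=0$, then $(\mathcal{M}^{\mathcal{U}}_{\mathcal{V}},\mathcal{N}^{\mathcal{X}}_{\mathcal{Y}})$ is a cotorsion pair in $\Lambda\text{-}\mathrm{Mod}$; and it is complete and hereditary if so are $(\mathcal{U},\mathcal{X})$ and $(\mathcal{V},\mathcal{Y})$.
   Context: Morita rings. Let $A,B$ be rings, ${}_BM_A$ and ${}_AN_B$ bimodules, $\phi:M\otimes_AN\to B$ a $B$-bimodule map and $\psi:N\otimes_BM\to A$ an $A$-bimodule map such that $m'\psi(n\otimes m)=\phi(m'\otimes n)m$ and $n'\phi(m\otimes n)=\psi(n'\otimes m)n$ for all $m,m'\in M$, $n,n'\in N$. The Morita ring $\Lambda_{(\phi,\psi)}=\begin{pmatrix} A & N \\ M & B \end{pmatrix}$ has componentwise addition and multiplication $\begin{pmatrix} a & n \\ m & b \end{pmatrix}\begin{pmatrix} a' & n' \\ m' & b' \end{pmatrix}=\begin{pmatrix} aa'+\psi(n\otimes m') & an'+nb' \\ ma'+bm' & \phi(m\otimes n')+bb' \end{pmatrix}$. Left $\Lambda$-modules are identified with quadruples $\begin{pmatrix} X \\ Y \end{pmatrix}_{f,g}$, where $X\in A\text{-}\mathrm{Mod}$, $Y\in B\text{-}\mathrm{Mod}$, $f\in\operatorname{Hom}_B(M\otimes_AX,Y)$, $g\in\operatorname{Hom}_A(N\otimes_BY,X)$ satisfy $g(n\otimes f(m\otimes x))=\psi(n\otimes m)x$ and $f(m\otimes g(n\otimes y))=\phi(m\otimes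 n)y$ for all $m\in M,n\in N,x\in X,y\in Y$; homomorphisms are pairs $(a,b)$ of an $A$-map and a $B$-map compatible with the $f$'s and $g$'s. $\tilde f:X\to\operatorname{Hom}_B(M,Y)$ and $\tilde g:Y\to\operatorname{Hom}_A(N,X)$ denote the maps corresponding to $f$ and $g$ under the tensor-Hom adjunctions. All classes of modules are closed under isomorphisms; $\operatorname{Tor}_1^B(N,\mathcal{C})=0$ means vanishing on every object of $\mathcal{C}$, and similarly for $\operatorname{Ext}$. Cotorsion pairs. For a class $\mathcal{C}$ of modules, $\mathcal{C}^\perp=\{X\mid\operatorname{Ext}^1(C,X)=0\ \forall C\in\mathcal{C}\}$ and ${}^\perp\mathcal{C}=\{X\mid\operatorname{Ext}^1(X,C)=0\ \forall C\in\mathcal{C}\}$. $(\mathcal{C},\mathcal{D})$ is a cotorsion pair if $\mathcal{C}^\perp=\mathcal{D}$ and ${}^\perp\mathcal{D}=\mathcal{C}$. It is complete if for each module $Z$ there are short exact sequences $0\to D_1\to C_1\to Z\to0$ and $0\to Z\to D_2\to C_2\to0$ with $C_i\in\mathcal{C}$, $D_i\in\mathcal{D}$. It is hereditary if $\mathcal{C}$ is closed under kernels of epimorphisms and $\mathcal{D}$ is closed under cokernels of monomorphisms. *)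

(* Defs.v *)
From HB Require Import structures.
From mathcomp Require Import all_boot all_algebra.
From mathcomp Require Import boolp.
From mathcomp.multinomials Require Import freeg.

Set Implicit Arguments.
Unset Strict Implicit.
Unset Printing Implicit Defensive.

Import GRing.Theory.
Local Open Scope ring_scope.
Local Open Scope quotient_scope.

(* An R-S-bimodule: a left R-module with a commuting right S-action. *)
HB.mixin Record Lmodule_isBimodule (R S : pzRingType) M of GRing.Lmodule R M := {
  rscale : M -> S -> M;
  rscaleA : forall m s t, rscale (rscale m s) t = rscale m (s * t);
  rscale1 : forall m, rscale m 1 = m;
  rscaleDl : forall s, {morph rscale^~ s : m m' / m + m'};
  rscaleDr : forall m, {morph rscale m : s t / s + t};
  scaler_rscale : forall (r : R) m s, r *: rscale m s = rscale (r *: m) s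
}.

#[short(type="bimodType")]
HB.structure Definition Bimodule (R S : pzRingType) :=
  {M of GRing.Lmodule R M & Lmodule_isBimodule R S M}.

Section RegularBimodule.
Variable R : pzRingType.

Let regA (m s t : R^o) : m * s * t = m * (s * t). Proof. by rewrite mulrA. Qed.
Let reg1 (m : R^o) : m * 1 = m. Proof. exact: mulr1. Qed.
Let regDl (s : R) : {morph (fun m : R^o => m * s : R^o) : m m' / m + m'}.
Proof. by move=> m m'; exact: mulrDl. Qed.
Let regDr (m : R^o) : {morph (fun s : R => m * s : R^o) : s t / s + t}.
Proof. by move=> s t; exact: mulrDr. Qed.
Let reg_scale (r : R) (m : R^o) (s : R) :
  r *: (m * s : R^o) = (r *: m) * s :> R^o.
Proof. exact: mulrA. Qed.

HB.instance Definition _ := @Lmodule_isBimodule.Build R R R^o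
  (fun m s => m * s) regA reg1 regDl regDr reg_scale.

End RegularBimodule.

Section Cokernel.
Variables (R : pzRingType) (U V : lmodType R) (g : {linear U -> V}).

Definition img_pred : pred V := fun v => `[< exists u, g u = v >].

Let img_zmod : zmod_closed img_pred.
Proof.
split=> [|_ _ /asboolP[u <-] /asboolP[v <-]]; apply/asboolP.
  by exists 0; rewrite linear0.
by exists (u - v); rewrite linearB.
Qed.
HB.instance Definition _ := GRing.isZmodClosed.Build V img_pred img_zmod.

Definition img_sub : zmodClosed V := GRing.ZmodClosed.clone V img_pred _.

Definition coker : Type := Quotient.quot img_sub.
HB.instance Definition _ := GRing.Zmodule.on coker.
Definition coker_pi (v : V) : coker := \pi_(Quotient.quot img_sub) v.

Lemma coker_piP v w : coker_pi v = coker_pi w <-> exists u, g u = v - w.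
Proof.
rewrite /coker_pi; split=> [/eqP|h]; last apply/eqP.
  by rewrite -Quotient.idealrBE => /asboolP.
by rewrite -Quotient.idealrBE; apply/asboolP.
Qed.

Lemma coker_pi_surj q : exists v, coker_pi v = q.
Proof. by exists (repr (q : Quotient.quot img_sub)); exact: reprK. Qed.

Lemma coker_piD v w : coker_pi (v + w) = coker_pi v + coker_pi w.
Proof. exact: raddfD. Qed.

Definition coker_scale (r : R) (q : coker) : coker :=
  coker_pi (r *: repr (q : Quotient.quot img_sub)).

Lemma coker_scale_pi r v : coker_scale r (coker_pi v) = coker_pi (r *: v).
Proof.
apply/coker_piP.
have [u gu] : exists u, g u = repr (coker_pi v : Quotient.quot img_sub) - v.
  by apply/coker_piP; exact: reprK.
by exists (r *: u); rewrite linearZ /= gu scalerBr.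
Qed.

Let cokA a b v : coker_scale a (coker_scale b v) = coker_scale (a * b) v.
Proof. by have [w <-] := coker_pi_surj v; rewrite !coker_scale_pi scalerA. Qed.
Let cok1 : left_id 1 coker_scale.
Proof. by move=> v; have [w <-] := coker_pi_surj v; rewrite coker_scale_pi scale1r. Qed.
Let cokDr : right_distributive coker_scale +%R.
Proof.
move=> a v v'; have [w <-] := coker_pi_surj v; have [w' <-] := coker_pi_surj v'.
by rewrite -coker_piD !coker_scale_pi scalerDr coker_piD.
Qed.
Let cokDl v : {morph coker_scale^~ v : a b / a + b}.
Proof.
move=> a b; have [w <-] := coker_pi_surj v.
by rewrite !coker_scale_pi scalerDl coker_piD.
Qed.
HB.instance Definition _ :=
  GRing.Zmodule_isLmodule.Build R coker cokA cok1 cokDr cokDl.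

End Cokernel.

Section Kernel.
Variables (R : pzRingType) (U V : lmodType R) (f : {linear U -> V}).

Definition ker_pred : pred U := fun u => f u == 0.

Let ker_submod : submod_closed ker_pred.
Proof.
split=> [|a u v /eqP fu /eqP fv]; apply/eqP; first exact: linear0.
by rewrite linearP fu fv scaler0 addr0.
Qed.
HB.instance Definition _ := GRing.isSubmodClosed.Build R U ker_pred ker_submod.

Definition ker : Type := {u : U | u \in ker_pred}.
HB.instance Definition _ := SubChoice.on ker.
HB.instance Definition _ := [SubChoice_isSubLmodule of ker by <:].

End Kernel.

Section Tensor.
Variables (R S : pzRingType) (M : bimodType R S) (X : lmodType S).

Local Notation "[ m , x ]" := (<< (m : M, x : X) >> : {freeg (M * X)%type / int}).

(* The subgroup of the free abelian group on M x X generated by the relations of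
   the tensor product over S. *)
Inductive tensor_rel : {freeg (M * X)%type / int} -> Prop :=
| tensor_relDl m m' x : tensor_rel ([m + m', x] - [m, x] - [m', x])
| tensor_relDr m x x' : tensor_rel ([m, x + x'] - [m, x] - [m, x'])
| tensor_relS m s x : tensor_rel ([rscale m s, x] - [m, s *: x])
| tensor_rel0 : tensor_rel 0
| tensor_relB u v : tensor_rel u -> tensor_rel v -> tensor_rel (u - v).

Definition tensor_pred : pred {freeg (M * X)%type / int} :=
  fun u => `[< tensor_rel u >].

Let tensor_zmod : zmod_closed tensor_pred.
Proof.
split=> [|u v /asboolP ru /asboolP rv]; apply/asboolP; first exact: tensor_rel0.
exact: tensor_relB.
Qed.
HB.instance Definition _ := GRing.isZmodClosed.Build _ tensor_pred tensor_zmod.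

Definition tensor_sub : zmodClosed _ := GRing.ZmodClosed.clone _ tensor_pred _.

Definition tensor : Type := Quotient.quot tensor_sub.
HB.instance Definition _ := GRing.Zmodule.on tensor.

Definition tens (m : M) (x : X) : tensor := \pi_(Quotient.quot tensor_sub) [m, x].


Lemma tensDl m m' x : tens (m + m') x = tens m x + tens m' x.
Proof.
rewrite /tens -raddfD; apply/eqP; rewrite -Quotient.idealrBE opprD addrA.
by apply/asboolP; exact: tensor_relDl.
Qed.

Lemma tensDr m x x' : tens m (x + x') = tens m x + tens m x'.
Proof.
rewrite /tens -raddfD; apply/eqP; rewrite -Quotient.idealrBE opprD addrA.
by apply/asboolP; exact: tensor_relDr.
Qed.

Lemma tensS m s x : tens (rscale m s) x = tens m (s *: x).
Proof.
apply/eqP; rewrite -Quotient.idealrBE; apply/asboolP; exact: tensor_relS.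
Qed.

Section Lift.
Variables (G : zmodType) (b : M -> X -> G).

Definition tensor_lift (t : tensor) : G :=
  fglift (fun p : M * X => b p.1 p.2 : zmodule G) (repr (t : Quotient.quot tensor_sub)).

Definition balanced :=
  [/\ forall m m' x, b (m + m') x = b m x + b m' x,
      forall m x x', b m (x + x') = b m x + b m x'
    & forall m s x, b (rscale m s) x = b m (s *: x)].

Hypothesis bal : balanced.

Let L := fglift (fun p : M * X => b p.1 p.2 : zmodule G).
Let LB u v : L (u - v) = L u - L v.
Proof. exact: lift_is_additive. Qed.
Let LU m x : L [m, x] = b m x.
Proof. by rewrite /L liftU scalezrE. Qed.

Let L_rel u : tensor_rel u -> L u = 0.
Proof.
case: bal => bDl bDr bS.
elim=> [m m' x|m x x'|m s x||v w _ Lv _ Lw].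
- by rewrite !LB !LU bDl addrAC addrK subrr.
- by rewrite !LB !LU bDr addrAC addrK subrr.
- by rewrite LB !LU bS subrr.
- by rewrite -(subrr 0) LB subrr.
- by rewrite LB Lv Lw subrr.
Qed.

Let lift_pi u : tensor_lift (\pi_(Quotient.quot tensor_sub) u) = L u.
Proof.
apply/eqP; rewrite -subr_eq0 -LB; apply/eqP/L_rel/asboolP.
change (repr (\pi_(Quotient.quot tensor_sub) u) - u \in tensor_sub).
by rewrite Quotient.idealrBE reprK.
Qed.

Lemma tensor_lift_tens m x : tensor_lift (tens m x) = b m x.
Proof. by rewrite lift_pi LU. Qed.

Lemma tensor_liftB : {morph tensor_lift : t u / t - u}.
Proof.
move=> t u; rewrite -[t]reprK -[u]reprK.
by rewrite -(raddfB (\pi_(Quotient.quot tensor_sub))) !lift_pi LB.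
Qed.

Lemma tensor_liftD : {morph tensor_lift : t u / t + u}.
Proof.
have L0 : tensor_lift 0 = 0 by have := tensor_liftB 0 0; rewrite !subrr.
by move=> t u; rewrite -{1}[u]opprK -[- u]sub0r !tensor_liftB L0 sub0r opprK.
Qed.

End Lift.

Lemma tensor_ind (P : tensor -> Prop) :
  P 0 -> (forall m x t, P t -> P (tens m x + t)) -> forall t, P t.
Proof.
move=> P0 PD t; pose Q (v : tensor) := forall s, P s -> P (v + s).
suff Qtt : Q t by rewrite -[t]addr0; exact: Qtt.
have Q0 : Q 0 by move=> r; rewrite add0r.
have QD v w : Q v -> Q w -> Q (v + w).
  by move=> Qv Qw r Pr; rewrite -addrA; apply/Qv/Qw.
have Qt m x : Q (tens m x) by exact: PD.
have QM v n : Q v -> Q (v *+ n).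
  by move=> Qv; elim: n => // n IH; rewrite mulrS; exact: QD.
have tensN m x : tens (- m) x = - tens m x.
  have t0 : tens 0 x = 0 by apply: (addrI (tens 0 x)); rewrite -tensDl !addr0.
  by apply/eqP; rewrite -addr_eq0 -tensDl addNr t0.
rewrite -[t]reprK -[repr _]freeg_sumE raddf_sum.
elim: (dom _) => [|[m x] d IH]; first by rewrite big_nil.
rewrite big_cons; apply: QD => //=; move: (coeff _ _) => k.
have -> : << k *g (m, x) >> = << (m, x) >> *~ k :> {freeg (M * X)%type / int}.
  by rewrite freegU_mulz intz.
rewrite raddfMz; case: k => n; first by rewrite -pmulrn; apply/QM/Qt.
by rewrite NegzE -nmulrn -mulNrn -[- _]tensN; apply/QM/Qt.
Qed.

End Tensor.

Section TensorModule.
Variables (R S : pzRingType) (M : bimodType R S) (X : lmodType S).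
Local Notation T := (tensor M X).

Definition tensor_scale (r : R) : T -> T := tensor_lift (fun m x => tens (r *: m) x).

Lemma tensor_scale_balanced r : balanced (fun (m : M) (x : X) => tens (r *: m) x).
Proof.
split=> [m m' x|m x x'|m s x]; first by rewrite scalerDr tensDl.
  exact: tensDr.
by rewrite scaler_rscale tensS.
Qed.

Lemma tensor_scale_tens r m x : tensor_scale r (tens m x) = tens (r *: m) x.
Proof. by rewrite /tensor_scale tensor_lift_tens //; exact: tensor_scale_balanced. Qed.

Let scDr : right_distributive tensor_scale +%R.
Proof. by move=> r; apply: tensor_liftD; exact: tensor_scale_balanced. Qed.
Let sc0 r : tensor_scale r 0 = 0.
Proof. by apply: (addrI (tensor_scale r 0)); rewrite -scDr !addr0. Qed.
Let scA r r' t : tensor_scale r (tensor_scale r' t) = tensor_scale (r * r') t.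
Proof.
elim/tensor_ind: t => [|m x t IH]; first by rewrite !sc0.
by rewrite !scDr IH !tensor_scale_tens scalerA.
Qed.
Let sc1 : left_id 1 tensor_scale.
Proof.
elim/tensor_ind=> [|m x t IH]; first exact: sc0.
by rewrite scDr IH tensor_scale_tens scale1r.
Qed.
Let scDl t : {morph tensor_scale^~ t : r r' / r + r'}.
Proof.
move=> r r'; elim/tensor_ind: t => [|m x t IH]; first by rewrite !sc0 addr0.
by rewrite !scDr IH !tensor_scale_tens scalerDl tensDl addrACA.
Qed.
HB.instance Definition _ := GRing.Zmodule_isLmodule.Build R T scA sc1 scDr scDl.

Lemma scale_tens (r : R) (m : M) (x : X) : r *: tens m x = tens (r *: m) x.
Proof. exact: tensor_scale_tens. Qed.

End TensorModule.

Section TensorMap.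
Variables (R S : pzRingType) (M : bimodType R S) (X X' : lmodType S).
Variable h : {linear X -> X'}.

Definition tensor_map : tensor M X -> tensor M X' :=
  tensor_lift (fun m x => tens m (h x)).

Let bal : balanced (fun (m : M) (x : X) => tens m (h x)).
Proof.
split=> [m m' x|m x x'|m s x]; first exact: tensDl.
  by rewrite linearD tensDr.
by rewrite linearZ tensS.
Qed.

Lemma tensor_map_tens m x : tensor_map (tens m x) = tens m (h x).
Proof. by rewrite /tensor_map tensor_lift_tens. Qed.

Let mapD : {morph tensor_map : t u / t + u}. Proof. exact: tensor_liftD. Qed.
Let map_linear : linear tensor_map.
Proof.
move=> r t u; rewrite mapD; congr (_ + _).
have map0 : tensor_map 0 = 0.
  by apply: (addrI (tensor_map 0)); rewrite -mapD !addr0.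
elim/tensor_ind: t => [|m x t IH]; first by rewrite !(scaler0, map0).
by rewrite scalerDr !mapD IH scale_tens !tensor_map_tens scalerDr scale_tens.
Qed.
HB.instance Definition _ :=
  GRing.isLinear.Build R (tensor M X) (tensor M X') _ tensor_map map_linear.

End TensorMap.
Arguments tensor_map {R S} M {X X'} h.

(* [M ⊗ N] is a bimodule when [N] is one, via t s := (M ⊗ (- s)) t. *)
Section TensorBimodule.
Variables (R S Q : pzRingType) (M : bimodType R S) (N : bimodType S Q).

Definition rmul (q : Q) : N -> N := fun n => rscale n q.
Let rmul_linear q : linear (rmul q).
Proof. by move=> s m n; rewrite /rmul rscaleDl scaler_rscale. Qed.
HB.instance Definition _ q := GRing.isLinear.Build S N N _ (rmul q) (rmul_linear q).

Let T : lmodType R := tensor M N.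
Definition tensor_rscale (t : T) (q : Q) : T := tensor_map M (rmul q) t.

Lemma tensor_rscale_tens m n q : tensor_rscale (tens m n) q = tens m (rscale n q).
Proof. exact: tensor_map_tens. Qed.

Let tA t q q' : tensor_rscale (tensor_rscale t q) q' = tensor_rscale t (q * q').
Proof.
rewrite /tensor_rscale; elim/tensor_ind: t => [|m n t IH]; first by rewrite !linear0.
by rewrite !linearD /= IH !tensor_map_tens /= /rmul rscaleA.
Qed.
Let t1 t : tensor_rscale t 1 = t.
Proof.
rewrite /tensor_rscale; elim/tensor_ind: t => [|m n t IH]; first by rewrite !linear0.
by rewrite !linearD /= IH !tensor_map_tens /= /rmul rscale1.
Qed.
Let tDl q : {morph tensor_rscale^~ q : t t' / t + t'}.
Proof. by move=> t t'; exact: linearD. Qed.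
Let tDr t : {morph tensor_rscale t : q q' / q + q'}.
Proof.
move=> q q'; rewrite /tensor_rscale.
elim/tensor_ind: t => [|m n t IH]; first by rewrite !linear0 addr0.
by rewrite !linearD /= IH !tensor_map_tens /= /rmul rscaleDr tensDr addrACA.
Qed.
Let tS (r : R) t q : r *: tensor_rscale t q = tensor_rscale (r *: t) q.
Proof. by rewrite /tensor_rscale linearZ. Qed.

HB.instance Definition _ :=
  Lmodule_isBimodule.Build R Q (tensor M N) tA t1 tDl tDr tS.

Lemma rscale_tens (m : M) (n : N) (q : Q) :
  rscale (tens m n : tensor M N) q = tens m (rscale n q).
Proof. exact: tensor_rscale_tens. Qed.

End TensorBimodule.

(* Hom_R(M, Y) as a left S-module: (s h)(m) = h(m s). *)
Section HomModule.
Variables (R S : pzRingType) (M : bimodType R S) (Y : lmodType R).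

Definition homMod : Type := {linear M -> Y}.
HB.instance Definition _ := gen_eqMixin homMod.
HB.instance Definition _ := gen_choiceMixin homMod.

Definition hom_fun (h : homMod) : M -> Y := GRing.Linear.sort h.

Lemma hom_ext (h k : homMod) : hom_fun h =1 hom_fun k -> h = k.
Proof.
case: h k => h [[h1] [h2]] [k [[k1] [k2]]] /= /funext hk.
rewrite /hom_fun /= in hk; case: _ / hk in k1 k2 *.
by rewrite (Prop_irrelevance h1 k1) (Prop_irrelevance h2 k2).
Qed.

Let zero_linear : linear (fun _ : M => 0 : Y).
Proof. by move=> r m m'; rewrite scaler0 addr0. Qed.
Let add_linear (h k : homMod) : linear (fun m => hom_fun h m + hom_fun k m).
Proof. by move=> r m m'; rewrite /hom_fun !linearP scalerDr addrACA. Qed.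
Let opp_linear (h : homMod) : linear (fun m => - hom_fun h m).
Proof. by move=> r m m'; rewrite /hom_fun linearP opprD scalerN. Qed.
Let scale_linear (s : S) (h : homMod) : linear (fun m => hom_fun h (rscale m s)).
Proof. by move=> r m m'; rewrite /hom_fun rscaleDl -scaler_rscale linearP. Qed.

Let mk (f : M -> Y) (lf : linear f) : homMod :=
  HB.pack f (GRing.isLinear.Build R M Y _ f lf).

Definition hom_zero : homMod := mk zero_linear.
Definition hom_add h k : homMod := mk (add_linear h k).
Definition hom_opp h : homMod := mk (opp_linear h).
Definition hom_scale s h : homMod := mk (scale_linear s h).

Let homA : associative hom_add.
Proof. by move=> h k l; apply: hom_ext => m; exact: addrA. Qed.
Let homC : commutative hom_add.
Proof. by move=> h k; apply: hom_ext => m; exact: addrC. Qed.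
Let hom0 : left_id hom_zero hom_add.
Proof. by move=> h; apply: hom_ext => m; exact: add0r. Qed.
Let homN : left_inverse hom_zero hom_opp hom_add.
Proof. by move=> h; apply: hom_ext => m; exact: addNr. Qed.
HB.instance Definition _ := GRing.isZmodule.Build homMod homA homC hom0 homN.

Let hsA s t h : hom_scale s (hom_scale t h) = hom_scale (s * t) h.
Proof. by apply: hom_ext => m; rewrite /hom_fun /= /hom_fun rscaleA. Qed.
Let hs1 : left_id 1 hom_scale.
Proof. by move=> h; apply: hom_ext => m; rewrite /hom_fun /= /hom_fun rscale1. Qed.
Let hsDr : right_distributive hom_scale +%R.
Proof. by move=> s h k; apply: hom_ext. Qed.
Let hsDl h : {morph hom_scale^~ h : s t / s + t}.
Proof.
by move=> s t; apply: hom_ext => m; rewrite /hom_fun /= /hom_fun rscaleDr linearD.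
Qed.
HB.instance Definition _ :=
  GRing.Zmodule_isLmodule.Build S homMod hsA hs1 hsDr hsDl.

End HomModule.

Section Adjoint.
Variables (R S : pzRingType) (M : bimodType R S).
Variables (X : lmodType S) (Y : lmodType R) (f : {linear tensor M X -> Y}).

Let adj_fun_linear x : linear (fun m => f (tens m x)).
Proof. by move=> r m m'; rewrite tensDl -scale_tens linearP. Qed.

Definition adj (x : X) : homMod M Y :=
  HB.pack (fun m => f (tens m x)) (GRing.isLinear.Build R M Y _ _ (adj_fun_linear x)).

Let adj_linear : linear adj.
Proof.
move=> s x x'; apply: hom_ext => m.
by rewrite /hom_fun /= tensDr linearD -tensS.
Qed.
HB.instance Definition _ := GRing.isLinear.Build S X (homMod M Y) _ adj adj_linear.

End Adjoint.

Definition surj (U V : Type) (f : U -> V) := forall v, exists u, f u = v.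

Definition exact_at (U V W : zmodType) (f : U -> V) (g : V -> W) :=
  forall v, g v = 0 <-> exists u, f u = v.

Section Modules.
Variable R : pzRingType.
Implicit Types U V W C D X Z : lmodType R.

Definition iso U V := exists h : {linear U -> V}, bijective h.

Definition short_exact U V W (i : {linear U -> V}) (p : {linear V -> W}) :=
  [/\ injective i, exact_at i p & surj p].

Definition projective (P : lmodType R) :=
  forall V W (p : {linear V -> W}) (h : {linear P -> W}), surj p ->
    exists k : {linear P -> V}, forall x, p (k x) = h x.

Record proj_resolution C := ProjResolution {
  res_mod : nat -> lmodType R;
  res_d : forall n, {linear res_mod n.+1 -> res_mod n};
  res_aug : {linear res_mod 0 -> C};
  res_proj : forall n, projective (res_mod n);
  res_exact : forall n, exact_at (res_d n.+1) (res_d n);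
  res_exact0 : exact_at (res_d 0) res_aug;
  res_surj : surj res_aug
}.

(* Ext^1_R(C, X) = H^1(Hom_R(P, X)) = 0, for P -> C a projective resolution
   (independent of the choice of P). *)
Definition Ext1_eq0 C X := forall P : proj_resolution C,
  forall h : {linear res_mod P 1 -> X}, (forall z, h (res_d P 1 z) = 0) ->
  exists k : {linear res_mod P 0 -> X}, forall z, h z = k (res_d P 0 z).

Definition mod_class := lmodType R -> Prop.
Implicit Types CC DD : mod_class.

Definition rperp CC : mod_class := fun X => forall C, CC C -> Ext1_eq0 C X.
Definition lperp CC : mod_class := fun X => forall C, CC C -> Ext1_eq0 X C.

Definition cotorsion_pair CC DD :=
  (forall X, rperp CC X <-> DD X) /\ (forall X, lperp DD X <-> CC X).

Definition complete_pair CC DD := forall Z,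
  (exists (D1 C1 : lmodType R) (i : {linear D1 -> C1}) (p : {linear C1 -> Z}),
     [/\ CC C1, DD D1 & short_exact i p]) /\
  (exists (D2 C2 : lmodType R) (i : {linear Z -> D2}) (p : {linear D2 -> C2}),
     [/\ CC C2, DD D2 & short_exact i p]).

Definition hereditary_pair CC DD :=
  (forall V W (p : {linear V -> W}), CC V -> CC W -> surj p -> CC (ker p)) /\
  (forall U V (i : {linear U -> V}), DD U -> DD V -> injective i -> DD (coker i)).

End Modules.

(* Tor_1^S(N, Y) = H_1(N ⊗ P) = 0, for P -> Y a projective resolution. *)
Definition Tor1_eq0 (R S : pzRingType) (N : bimodType R S) (Y : lmodType S) :=
  forall P : proj_resolution Y,
    exact_at (tensor_map N (res_d P 1)) (tensor_map N (res_d P 0)).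

Record morita_context (A B : pzRingType) (M : bimodType B A) (N : bimodType A B) :=
  MoritaContext {
  mphi : {linear tensor M N -> B^o};
  mpsi : {linear tensor N M -> A^o};
  mphi_rscale : forall t (b : B), mphi (rscale t b) = rscale (mphi t) b;
  mpsi_rscale : forall t (a : A), mpsi (rscale t a) = rscale (mpsi t) a;
  mphi_mpsi : forall (m m' : M) (n : N),
    rscale m' (mpsi (tens n m) : A) = (mphi (tens m' n) : B) *: m;
  mpsi_mphi : forall (m : M) (n n' : N),
    rscale n' (mphi (tens m n) : B) = (mpsi (tens n' m) : A) *: n
}.

Section MoritaRing.
Variables (A B : pzRingType) (M : bimodType B A) (N : bimodType A B).

(* [((a, n), (m, b))] is the matrix with rows (a n) and (m b). *)
Definition morita_ring of morita_context M N : Type := ((A * N) * (M * B))%type.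
HB.instance Definition _ c := GRing.Zmodule.on (morita_ring c).

Variable c : morita_context M N.

Local Notation phi m n := (mphi c (tens m n) : B).
Local Notation psi n m := (mpsi c (tens n m) : A).

Local Notation L := (morita_ring c).

Definition morita_one : L := ((1, 0), (0, 1)).

Definition morita_mul (x y : L) : L :=
  let: ((a, n), (m, b)) := x in
  let: ((a', n'), (m', b')) := y in
  ((a * a' + psi n m', a *: n' + rscale n b'),
   (rscale m a' + b *: m', phi m n' + b * b')).

Let psiDl n n' m : psi (n + n') m = psi n m + psi n' m.
Proof. by rewrite tensDl linearD. Qed.
Let psiDr n m m' : psi n (m + m') = psi n m + psi n m'.
Proof. by rewrite tensDr linearD. Qed.
Let psiZ a n m : psi (a *: n) m = a * psi n m.
Proof. by rewrite -scale_tens linearZ. Qed.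
Let psiM n m a : psi n (rscale m a) = psi n m * a.
Proof. by rewrite -rscale_tens mpsi_rscale. Qed.
Let psiS n b m : psi (rscale n b) m = psi n (b *: m).
Proof. by rewrite tensS. Qed.
Let psi0l m : psi 0 m = 0.
Proof. by apply: (addrI (psi 0 m)); rewrite -psiDl !addr0. Qed.
Let psi0r n : psi n 0 = 0.
Proof. by apply: (addrI (psi n 0)); rewrite -psiDr !addr0. Qed.
Let phiDl m m' n : phi (m + m') n = phi m n + phi m' n.
Proof. by rewrite tensDl linearD. Qed.
Let phiDr m n n' : phi m (n + n') = phi m n + phi m n'.
Proof. by rewrite tensDr linearD. Qed.
Let phiZ b m n : phi (b *: m) n = b * phi m n.
Proof. by rewrite -scale_tens linearZ. Qed.
Let phiM m n b : phi m (rscale n b) = phi m n * b.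
Proof. by rewrite -rscale_tens mphi_rscale. Qed.
Let phiS m a n : phi (rscale m a) n = phi m (a *: n).
Proof. by rewrite tensS. Qed.
Let phi0l n : phi 0 n = 0.
Proof. by apply: (addrI (phi 0 n)); rewrite -phiDl !addr0. Qed.
Let phi0r m : phi m 0 = 0.
Proof. by apply: (addrI (phi m 0)); rewrite -phiDr !addr0. Qed.

Let rscale0l (R S : pzRingType) (P : bimodType R S) (s : S) : rscale (0 : P) s = 0.
Proof. by apply: (addrI (rscale 0 s)); rewrite -rscaleDl !addr0. Qed.

Let mulA : associative morita_mul.
Proof.
move=> [[a n] [m b]] [[a' n'] [m' b']] [[a'' n''] [m'' b'']].
rewrite /morita_mul; congr (_, _, (_, _)).
- rewrite mulrDr mulrDl psiDl psiDr psiZ psiM psiS !mulrA -!addrA; congr (_ + _).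
  by rewrite addrCA.
- rewrite scalerDr scalerDl rscaleDl rscaleDr !scalerA rscaleA scaler_rscale.
  by rewrite mpsi_mphi -!addrA; congr (_ + _); rewrite addrCA.
- rewrite scalerDr scalerDl rscaleDl rscaleDr !scalerA rscaleA scaler_rscale.
  by rewrite mphi_mpsi -!addrA; congr (_ + _); rewrite addrCA.
- rewrite mulrDr mulrDl phiDl phiDr phiZ phiM phiS !mulrA -!addrA.
  by congr (_ + _); rewrite addrCA.
Qed.
Let mul1l : left_id morita_one morita_mul.
Proof.
move=> [[a n] [m b]]; rewrite /morita_mul /morita_one psi0l phi0l !mul1r !scale1r.
by rewrite !rscale0l !addr0 !add0r.
Qed.
Let mul1r : right_id morita_one morita_mul.
Proof.
move=> [[a n] [m b]]; rewrite /morita_mul /morita_one psi0r phi0r !mulr1 !rscale1.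
by rewrite !scaler0 !addr0 !add0r.
Qed.
Let mulDl : left_distributive morita_mul +%R.
Proof.
move=> [[a n] [m b]] [[a' n'] [m' b']] [[a'' n''] [m'' b'']].
rewrite /morita_mul; congr (_, _, (_, _)) => /=.
- by rewrite mulrDl psiDl addrACA.
- by rewrite scalerDl rscaleDl addrACA.
- by rewrite scalerDl rscaleDl addrACA.
- by rewrite mulrDl phiDl addrACA.
Qed.
Let mulDr : right_distributive morita_mul +%R.
Proof.
move=> [[a n] [m b]] [[a' n'] [m' b']] [[a'' n''] [m'' b'']].
rewrite /morita_mul; congr (_, _, (_, _)) => /=.
- by rewrite mulrDr psiDr addrACA.
- by rewrite scalerDr rscaleDr addrACA.
- by rewrite scalerDr rscaleDr addrACA.
- by rewrite mulrDr phiDr addrACA.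
Qed.
HB.instance Definition _ :=
  GRing.Zmodule_isPzRing.Build L mulA mul1l mul1r mulDl mulDr.

End MoritaRing.

Section MoritaModules.
Variables (A B : pzRingType) (M : bimodType B A) (N : bimodType A B).
Variable c : morita_context M N.

(* The quadruples (X, Y)_{f,g}. *)
Record quad := Quad {
  qX : lmodType A;
  qY : lmodType B;
  qf : {linear tensor M qX -> qY};
  qg : {linear tensor N qY -> qX};
  qgf : forall (n : N) (m : M) (x : qX),
    qg (tens n (qf (tens m x))) = (mpsi c (tens n m) : A) *: x;
  qfg : forall (m : M) (n : N) (y : qY),
    qf (tens m (qg (tens n y))) = (mphi c (tens m n) : B) *: y
}.

Definition quad_mod (q : quad) : Type := (qX q * qY q)%type.

Section QuadMod.
Variable q : quad.
HB.instance Definition _ := GRing.Zmodule.on (quad_mod q).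

Definition quad_scale (l : morita_ring c) (w : quad_mod q) : quad_mod q :=
  let: ((a, n), (m, b)) := l in
  let: (x, y) := w in
  (a *: x + qg q (tens n y), qf q (tens m x) + b *: y).

Let fDl m m' x : qf q (tens (m + m') x) = qf q (tens m x) + qf q (tens m' x).
Proof. by rewrite tensDl linearD. Qed.
Let fDr m x x' : qf q (tens m (x + x')) = qf q (tens m x) + qf q (tens m x').
Proof. by rewrite tensDr linearD. Qed.
Let fS m a x : qf q (tens (rscale m a) x) = qf q (tens m (a *: x)).
Proof. by rewrite tensS. Qed.
Let fZ b m x : qf q (tens (b *: m) x) = b *: qf q (tens m x).
Proof. by rewrite -scale_tens linearZ. Qed.
Let gDl n n' y : qg q (tens (n + n') y) = qg q (tens n y) + qg q (tens n' y).
Proof. by rewrite tensDl linearD. Qed.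
Let gDr n y y' : qg q (tens n (y + y')) = qg q (tens n y) + qg q (tens n y').
Proof. by rewrite tensDr linearD. Qed.
Let gS n b y : qg q (tens (rscale n b) y) = qg q (tens n (b *: y)).
Proof. by rewrite tensS. Qed.
Let gZ a n y : qg q (tens (a *: n) y) = a *: qg q (tens n y).
Proof. by rewrite -scale_tens linearZ. Qed.

Let qA k l w : quad_scale k (quad_scale l w) = quad_scale (k * l) w.
Proof.
case: k l w => [[a n] [m b]] [[a' n'] [m' b']] [x y] /=; congr (_, _).
- rewrite scalerDr gDr !scalerDl gDl qgf gS gZ scalerA -!addrA.
  by congr (_ + _); rewrite addrCA.
- rewrite scalerDr fDr !scalerDl fDl qfg fS fZ scalerA -!addrA.
  by congr (_ + _); rewrite addrCA.
Qed.
Let q1 : left_id 1 quad_scale.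
Proof.
move=> [x y] /=; rewrite !scale1r.
have -> : qg q (tens 0 y) = 0 by apply: (addrI (qg q (tens 0 y))); rewrite -gDl !addr0.
have -> : qf q (tens 0 x) = 0 by apply: (addrI (qf q (tens 0 x))); rewrite -fDl !addr0.
by rewrite addr0 add0r.
Qed.
Let qDr : right_distributive quad_scale +%R.
Proof.
move=> [[a n] [m b]] [x y] [x' y'] /=; congr (_, _) => /=.
- by rewrite scalerDr gDr addrACA.
- by rewrite scalerDr fDr addrACA.
Qed.
Let qDl w : {morph quad_scale^~ w : k l / k + l}.
Proof.
move=> [[a n] [m b]] [[a' n'] [m' b']]; case: w => x y /=; congr (_, _) => /=.
- by rewrite scalerDl gDl addrACA.
- by rewrite scalerDl fDl addrACA.
Qed.
HB.instance Definition _ :=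
  GRing.Zmodule_isLmodule.Build (morita_ring c) (quad_mod q) qA q1 qDr qDl.

End QuadMod.

(* A class of quadruples is regarded as an isomorphism-closed class of left
   modules over the Morita ring. *)
Definition class_of_quads (Q : quad -> Prop) : mod_class (morita_ring c) :=
  fun W => exists2 q : quad, Q q & iso W (quad_mod q).

Definition classM (U : mod_class A) (V : mod_class B) : mod_class (morita_ring c) :=
  class_of_quads (fun q => [/\ U (coker (qg q)), V (qY q) & injective (qg q)]).

Definition classN (X : mod_class A) (Y : mod_class B) : mod_class (morita_ring c) :=
  class_of_quads (fun q => [/\ X (ker (adj (qf q))), Y (qY q) & surj (adj (qf q))]).

End MoritaModules.

Arguments classM {A B M N} c U V.
Arguments classN {A B M N} c X Y.

(* Main.v *)
Require Import Defs.
From HB Require Import structures.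
From mathcomp Require Import all_boot all_algebra.
From mathcomp Require Import boolp classical_sets.
From mathcomp.multinomials Require Import freeg.

(* Vanishing of Ext^1 is expressed by splitting of extensions. Since N ⊗ M = 0, psi
   vanishes, so a Λ-module amounts to maps h : X -> Hom(M, Y) and g : N ⊗ Y -> X whose
   composite is the map N ⊗ Y -> Hom(M, Y) induced by phi. Extensions of A- or B-modules
   are turned into extensions of Λ-modules by pushouts and pullbacks of such data, which
   shows that
   - N^X_Y is the right orthogonal of the modules (C, 0), C in U, and (N ⊗ C, C), C in V,
     if Tor_1(N, V) = 0;
   - M^U_V is the left orthogonal of the modules (C, 0), C in X, and (Hom(M, C), C),
     C in Y, if Ext^1(M, Y) = 0.
   As all these modules lie in M^U_V, resp. N^X_Y, and 0 -> (N ⊗ Y, Y) -> (X, Y) ->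
   (Coker g, 0) -> 0 is exact for (X, Y) in M^U_V, the two classes form a cotorsion pair.
   A special preenvelope of (X, Y) in N^X_Y is obtained in three steps: push out along a
   preenvelope of Y, add a projective to make h surjective, and push out along a
   preenvelope of Ker h. Salce's lemma then yields the precovers. *)

Set Implicit Arguments.
Unset Strict Implicit.
Unset Printing Implicit Defensive.

Import GRing.Theory Num.Theory.
Local Open Scope ring_scope.

(** * Linear maps *)

(** The test modules are chosen so that a Λ-extension against one of them reads off a single
    component: Ker h, Coker g or Y. Recovering the condition on Y rests on the Tor and Ext
    hypotheses: an extension of B-modules becomes the lower row of an extension of Λ-modules, whose
    upper row is exact because N ⊗ - keeps its left map injective, or Hom(M, -) keeps its right map
    surjective. The conditions that h be onto and that g be one-to-one need test modules of their
    own. Projectives lie in U, so (P, 0) with P covering Hom(M, Y) detects the former; dually,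
    injectives lie in X, and the latter is detected by (I, 0) with I = Hom_Z(A, Q/Z). It is enough
    that I be injective and separate elements, so no embedding into injectives is constructed;
    character modules serve this purpose only. Enough projectives also explain why only right
    approximations and closure of the left class under kernels are proved by hand: the rest follows
    formally. *)

Section LinearMaps.
Variable R : pzRingType.
Implicit Types U V W X : lmodType R.

Definition mklin U V (f : U -> V) (lf : linear f) : {linear U -> V} :=
  HB.pack f (GRing.isLinear.Build R U V _ f lf).

Definition comp_lin U V W (g : {linear V -> W}) (f : {linear U -> V}) :
  {linear U -> W} := g \o f.

Lemma comp_linE U V W (g : {linear V -> W}) (f : {linear U -> V}) u :
  comp_lin g f u = g (f u).
Proof. by []. Qed.

Definition id_lin U : {linear U -> U} := idfun.
Definition zero_lin U V : {linear U -> V} := \0.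
Definition sub_lin U V (f g : {linear U -> V}) : {linear U -> V} := f \- g.

Lemma ker_inj U V (f : {linear U -> V}) : (forall u, f u = 0 -> u = 0) -> injective f.
Proof. by move=> h u v e; apply/eqP; rewrite -subr_eq0; apply/eqP/h; rewrite linearB e subrr. Qed.

Lemma inj_ker U V (f : {linear U -> V}) u : injective f -> f u = 0 -> u = 0.
Proof. by move=> i e; apply: i; rewrite e linear0. Qed.

(** A preimage under [p] is picked by choice; the kernel condition makes the value of [h]
    independent of it, which gives linearity. Maps out of cokernels and pushouts are built with
    this. *)
Lemma factor_surj V W X (p : {linear V -> W}) (h : {linear V -> X}) :
  surj p -> (forall v, p v = 0 -> h v = 0) ->
  exists k : {linear W -> X}, forall v, k (p v) = h v.
Proof.
move=> sp ph; pose s w := projT1 (cid (sp w)).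
have ps w : p (s w) = w by rewrite /s; case: cid.
have hE v v' : p v = p v' -> h v = h v'.
  by move=> e; apply/eqP; rewrite -subr_eq0 -linearB; apply/eqP/ph; rewrite linearB e subrr.
have lk : linear (fun w => h (s w)).
  by move=> r w w'; rewrite -linearP; apply: hE; rewrite linearP !ps.
by exists (mklin lk) => v; apply: hE.
Qed.

Lemma factor_inj U V W (i : {linear U -> V}) (h : {linear W -> V}) :
  injective i -> (forall w, exists u, i u = h w) ->
  exists k : {linear W -> U}, forall w, i (k w) = h w.
Proof.
move=> ii ih; pose s w := projT1 (cid (ih w)).
have is_ w : i (s w) = h w by rewrite /s; case: cid.
have lk : linear s by move=> r w w'; apply: ii; rewrite linearP !is_ linearP.
by exists (mklin lk).
Qed.

Definition pair_lin U V W (f : {linear U -> V}) (g : {linear U -> W}) :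
  {linear U -> (V * W)%type} := @mklin U (V * W)%type (fun u => (f u, g u))
  (fun r u u' => congr2 pair (linearP f r u u') (linearP g r u u')).

Lemma copair_linear U V W (f : {linear U -> W}) (g : {linear V -> W}) :
  linear (fun p : (U * V)%type => f p.1 + g p.2).
Proof. by move=> r u u'; rewrite /= !linearP scalerDr addrACA. Qed.
Definition copair_lin U V W (f : {linear U -> W}) (g : {linear V -> W}) :=
  mklin (copair_linear f g).

Definition fst_lin U V : {linear (U * V)%type -> U} := fst.
Definition snd_lin U V : {linear (U * V)%type -> V} := snd.

Lemma coker_pi_linear U V (g : {linear U -> V}) : linear (coker_pi g).
Proof. by move=> r v w; rewrite coker_piD -coker_scale_pi. Qed.

End LinearMaps.
Definition coker_lin (R : pzRingType) (U V : lmodType R) (g : {linear U -> V}) :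
  {linear V -> coker g} := mklin (coker_pi_linear g).

Section Ker.
Variables (R : pzRingType) (U V : lmodType R) (f : {linear U -> V}).

Definition ker_lin : {linear ker f -> U} := (val : ker f -> U).

Lemma ker_linK (u : ker f) : f (ker_lin u) = 0.
Proof. by apply/eqP; exact: (valP u). Qed.

Lemma ker_lin_inj : injective ker_lin.
Proof. exact: val_inj. Qed.

Lemma ker_linP u : f u = 0 <-> exists k, ker_lin k = u.
Proof.
split=> [/eqP fu|[k <-]]; last exact: ker_linK.
by exists (exist _ u fu).
Qed.

Lemma coker_lin_surj : surj (coker_lin f).
Proof. exact: coker_pi_surj. Qed.

Lemma coker_linP v : coker_lin f v = 0 <-> exists u, f u = v.
Proof.
rewrite -(linear0 (coker_lin f)) /=; split.
  by move/coker_piP => -[u e]; exists u; rewrite e subr0.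
by move=> [u e]; apply/coker_piP; exists u; rewrite e subr0.
Qed.

Lemma short_exact_coker : injective f -> short_exact f (coker_lin f).
Proof. by split=> //; [exact: coker_linP|exact: coker_lin_surj]. Qed.

Lemma short_exact_ker : surj f -> short_exact ker_lin f.
Proof. by split=> //; [exact: ker_lin_inj|exact: ker_linP]. Qed.

End Ker.

(** * Pushouts and pullbacks *)

Section Squares.
Variable R : pzRingType.
Implicit Types U V W X : lmodType R.

(** The cokernel of u -> (- h u, i u). It is described by generators and relations: [factor_surj]
    applied to [copair_lin j l] turns this description into maps out of [Q]. *)
Lemma pushout U V X (i : {linear U -> V}) (h : {linear U -> X}) :
  exists (Q : lmodType R) (j : {linear X -> Q}) (l : {linear V -> Q}),
    [/\ forall q, exists x v, q = j x + l v
      & forall x v, j x + l v = 0 <-> exists2 u, v = i u & x = - h u].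
Proof.
pose d := pair_lin (sub_lin (zero_lin U X) h) i.
have e x v : coker_lin d (x, v) = coker_lin d (x, 0) + coker_lin d (0, v).
  by rewrite -linearD; congr (coker_lin d (_, _)); rewrite /= ?addr0 ?add0r.
exists (coker d), (comp_lin (coker_lin d) (pair_lin (id_lin X) (zero_lin X V))),
  (comp_lin (coker_lin d) (pair_lin (zero_lin V X) (id_lin V))); split=> [q|x v].
  by have [[x v] <-] := coker_lin_surj q; exists x, v; exact: e.
rewrite -[_ + _](e x v) coker_linP; split=> -[u].
  by rewrite /= sub0r => -[<- <-]; exists u.
by move=> -> ->; exists u; rewrite /= sub0r.
Qed.

(** The kernel of (v, x) -> p v - h x. The last clause is joint injectivity of the projections, the
    form in which [factor_inj] produces maps into [Q]. *)
Lemma pullback V W X (p : {linear V -> W}) (h : {linear X -> W}) :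
  exists (Q : lmodType R) (a : {linear Q -> V}) (b : {linear Q -> X}),
    [/\ forall q, p (a q) = h (b q),
        forall v x, p v = h x -> exists q, a q = v /\ b q = x
      & forall q, a q = 0 -> b q = 0 -> q = 0].
Proof.
pose d := copair_lin p (sub_lin (zero_lin X W) h).
have dE v x : d (v, x) = p v - h x by rewrite /= sub0r.
exists (ker d), (comp_lin (fst_lin _ _) (ker_lin d)), (comp_lin (snd_lin _ _) (ker_lin d)).
split=> [q|v x e|q e1 e2].
- have := ker_linK q; rewrite [ker_lin d q]surjective_pairing dE => /eqP.
  by rewrite subr_eq0 => /eqP.
- have /ker_linP[q qE] : d (v, x) = 0 by rewrite dE e subrr.
  by exists q; split; [exact: (congr1 fst qE)|exact: (congr1 snd qE)].
- apply: (inj_ker (@ker_lin_inj _ _ _ d)); rewrite [LHS]surjective_pairing.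
  by congr (_, _).
Qed.

End Squares.

(** * Free modules and projective resolutions *)

Definition mkadditive (G H : zmodType) (F : G -> H) (FB : {morph F : x y / x - y}) :
  {additive G -> H} := HB.pack F (GRing.isZmodMorphism.Build G H F FB).

Section FreeModule.
Variable R : pzRingType.

(* [R] as an R-Z-bimodule; [R^o] itself already carries its R-R-bimodule structure. *)
Definition regZ : Type := R^o.
HB.instance Definition _ := GRing.Lmodule.on regZ.

Let zA (m : regZ) (s t : int) : m *~ s *~ t = m *~ (s * t). Proof. by rewrite mulrzA. Qed.
Let z1 (m : regZ) : m *~ 1 = m. Proof. exact: mulr1z. Qed.
Let zDl (s : int) : {morph (fun m : regZ => m *~ s) : m m' / m + m'}.
Proof. by move=> m m'; exact: mulrzDl. Qed.
Let zDr (m : regZ) : {morph (fun s : int => m *~ s) : s t / s + t}.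
Proof. by move=> s t; exact: mulrzDr. Qed.
Let zS (r : R) (m : regZ) (s : int) : r *: (m *~ s) = (r *: m) *~ s.
Proof. by rewrite raddfMz. Qed.
HB.instance Definition _ := @Lmodule_isBimodule.Build R int regZ _ zA z1 zDl zDr zS.

Definition regZ1 : regZ := (1 : R).

Variable K : choiceType.
(** The free abelian group on [K], base-changed from the integers to [R], with basis [free_gen]. *)
Definition free_mod : lmodType R := tensor regZ {freeg K / int}.
Definition free_gen (k : K) : free_mod := tens regZ1 << k >>.

Lemma freeg_additive_ext (G : zmodType) (F F' : {additive {freeg K / int} -> G}) :
  (forall k, F << k >> = F' << k >>) -> F =1 F'.
Proof.
move=> e u; rewrite -[u]freeg_sumE !raddf_sum; apply: eq_bigr => k _ /=.
by rewrite -[coeff _ _]intz -freegU_mulz !raddfMz e.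
Qed.

Lemma free_mod_ext (W : lmodType R) (h h' : {linear free_mod -> W}) :
  (forall k, h (free_gen k) = h' (free_gen k)) -> h =1 h'.
Proof.
move=> e; elim/tensor_ind=> [|m u t IH]; first by rewrite !linear0.
rewrite !linearD IH; congr (_ + _).
(* This reduces the claim to elements 1 ⊗ u, where both maps are additive in u and hence determined
   on [K]. *)
have -> : tens m u = (m : R) *: tens regZ1 u :> free_mod.
  by rewrite scale_tens; congr tens; rewrite /GRing.scale /= mulr1.
rewrite !linearZ; congr (_ *: _).
have aB (k : {linear free_mod -> W}) :
    {morph (fun u => k (tens regZ1 u)) : x y / x - y}.
  move=> x y; rewrite -linearB; congr (k _).
  by apply/eqP; rewrite eq_sym subr_eq -tensDr subrK.
exact: (freeg_additive_ext (F := mkadditive (aB h)) (F' := mkadditive (aB h'))).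
Qed.

Lemma free_mod_univ (W : lmodType R) (v : K -> W) :
  exists h : {linear free_mod -> W}, forall k, h (free_gen k) = v k.
Proof.
have LB : {morph fglift (v : K -> zmodule W) : x y / (x - y : {freeg K / int}) >-> x - y}.
  exact: lift_is_additive.
pose L : {additive {freeg K / int} -> W} := mkadditive LB.
have LU x : L << x >> = v x by rewrite /L /= liftU scalezrE.
have bal : balanced (fun (r : regZ) u => (r : R) *: L u).
  split=> [r r' u|r u u'|r s u]; first exact: scalerDl.
    by rewrite raddfD scalerDr.
  by rewrite -[s in s *: u]intz scaler_int raddfMz -scalerMzr scalerMzl.
pose h := tensor_lift (fun (r : regZ) u => (r : R) *: L u).
have hD := tensor_liftD bal; have hE := tensor_lift_tens bal.
have lh : linear h.
  move=> r t u; rewrite /h hD; congr (_ + _).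
  have h0 : h 0 = 0 by apply: (addrI (h 0)); rewrite -hD !addr0.
  elim/tensor_ind: t => [|m x t IH]; first by rewrite scaler0 -/h h0 scaler0.
  by rewrite scalerDr !hD IH scale_tens !hE scalerDr scalerA.
by exists (mklin lh) => k; rewrite /= /h hE LU scale1r.
Qed.

Lemma free_mod_projective : projective free_mod.
Proof.
move=> V W p h sp; have [k kE] := free_mod_univ (fun x => projT1 (cid (sp (h (free_gen x))))).
exists k => x; apply: (free_mod_ext (h := comp_lin p k)) => y /=.
by rewrite /comp_lin /= kE; case: cid.
Qed.

End FreeModule.

Section Resolution.
Variable R : pzRingType.
Implicit Types (C P U V W X : lmodType R).

Definition cover W : lmodType R := free_mod R W.

Lemma cover_exists W : exists p : {linear cover W -> W}, surj p.
Proof.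
have [p pE] := free_mod_univ (id : W -> W).
by exists p => w; exists (free_gen R w).
Qed.

Definition cover_map W : {linear cover W -> W} := projT1 (cid (cover_exists W)).

Lemma cover_map_surj W : surj (cover_map W).
Proof. by rewrite /cover_map; case: cid. Qed.

Fixpoint syzygy W n : lmodType R :=
  if n is n'.+1 then ker (cover_map (syzygy W n')) else W.

(** Each differential is the cover of a syzygy followed by the inclusion into the previous cover.
    The definition is transparent so that its modules and maps compute to [cover], [syzygy] and
    [cover_map]. *)
Definition free_resolution W : proj_resolution W.
Proof.
refine (@ProjResolution R W (fun n => cover (syzygy W n))
  (fun n => comp_lin (ker_lin (cover_map (syzygy W n))) (cover_map (syzygy W n.+1)))
  (cover_map W) _ _ _ _).
- by move=> n; exact: free_mod_projective.
- move=> n v; split=> [e|[u <-]] /=.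
    have /ker_linP[k <-] : cover_map (syzygy W n.+1) v = 0.
      by apply: (inj_ker (@ker_lin_inj _ _ _ (cover_map (syzygy W n)))).
    by have [u <-] := cover_map_surj k; exists u.
  change (ker_lin (cover_map (syzygy W n)) (cover_map (syzygy W n.+1)
    (ker_lin (cover_map (syzygy W n.+1)) (cover_map (syzygy W n.+2) u))) = 0).
  by rewrite ker_linK !linear0.
- move=> v; split=> [/ker_linP[k <-]|[u <-]].
    by have [u <-] := cover_map_surj k; exists u.
  exact: ker_linK.
- exact: cover_map_surj.
Defined.

End Resolution.

(** * Extensions *)

Section Extensions.
Variable R : pzRingType.
Implicit Types C E K P U V W X : lmodType R.

Definition ext_split C X := forall E (i : {linear X -> E}) (p : {linear E -> C}),
  short_exact i p -> exists s : {linear C -> E}, forall c, p (s c) = c.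

Lemma short_exact_comp0 X E C (i : {linear X -> E}) (p : {linear E -> C}) x :
  short_exact i p -> p (i x) = 0.
Proof. by move=> [_ ip _]; apply/ip; exists x. Qed.

(** The element e - s (p e) lies in the kernel of [p], so it factors through [i]. *)
Lemma section_retraction X E C (i : {linear X -> E}) (p : {linear E -> C}) :
  short_exact i p -> (exists s : {linear C -> E}, forall c, p (s c) = c) ->
  exists r : {linear E -> X}, forall x, r (i x) = x.
Proof.
move=> ex [s ps]; have [ii ip sp] := ex.
have [e|r rE] := factor_inj (h := sub_lin (id_lin E) (comp_lin s p)) ii.
  by apply/ip; rewrite /= linearB ps subrr.
exists r => x; apply: ii; rewrite rE /=.
by rewrite (short_exact_comp0 _ ex) linear0 subr0.
Qed.

(** The map e -> e - i (r e) vanishes on the image of [i], so it descends along [p]. *)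
Lemma retraction_section X E C (i : {linear X -> E}) (p : {linear E -> C}) :
  short_exact i p -> (exists r : {linear E -> X}, forall x, r (i x) = x) ->
  exists s : {linear C -> E}, forall c, p (s c) = c.
Proof.
move=> ex [r ri]; have [ii ip sp] := ex.
have [e|s sE] := factor_surj (h := sub_lin (id_lin E) (comp_lin i r)) sp.
  by move/ip => -[x <-]; rewrite /= ri subrr.
exists s => c; have [e <-] := sp c; rewrite sE /= linearB.
by rewrite (short_exact_comp0 _ ex) subr0.
Qed.

(** A pushout leaves the cokernel unchanged and keeps the left map injective. The last two clauses
    retain the presentation of [E'], from which maps out of it are built. *)
Lemma pushout_exact X E C X' (i : {linear X -> E}) (p : {linear E -> C})
    (h : {linear X -> X'}) : short_exact i p ->
  exists E' (j : {linear X' -> E'}) (l : {linear E -> E'}) (q : {linear E' -> C}),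
  [/\ short_exact j q, forall x, l (i x) = j (h x), forall e, q (l e) = p e,
      forall e', exists x e, e' = j x + l e
    & forall x e, j x + l e = 0 <-> exists2 u, e = i u & x = - h u].
Proof.
move=> ex; case: (ex) => ii ip sp.
have [E' [j [l [jl jl0]]]] := pushout i h.
have sjl : surj (copair_lin j l).
  by move=> e; have [x [v ->]] := jl e; exists (x, v).
have [v|q qE] := factor_surj (h := comp_lin p (snd_lin X' E)) sjl.
  case: v => x e /= /jl0 [u -> _]; exact: short_exact_comp0.
have qj x : q (j x) = 0.
  by have := qE (x, 0); rewrite /= linear0 addr0 => ->; exact: linear0.
have ql e : q (l e) = p e.
  by have := qE (0, e); rewrite /= linear0 add0r.
exists E', j, l, q; split=> //; last first.
  move=> x; apply/eqP; rewrite -subr_eq0 addrC -linearN; apply/eqP/jl0.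
  by exists x.
split=> [|e|c]; last by have [e <-] := sp c; exists (l e).
  apply: ker_inj => x e; have /jl0[u] : j x + l 0 = 0 by rewrite linear0 addr0.
  by move/esym/(inj_ker ii) => -> ->; rewrite linear0 oppr0.
split=> [|[x <-]] //; have [x [v ->]] := jl e.
rewrite linearD qj add0r ql => /ip[u <-]; exists (x + h u).
rewrite linearD; congr (_ + _); apply/eqP; rewrite -subr_eq0 -opprB oppr_eq0.
by rewrite addrC -linearN; apply/eqP/jl0; exists u.
Qed.

Lemma pullback_exact X E C C' (i : {linear X -> E}) (p : {linear E -> C})
    (h : {linear C' -> C}) : short_exact i p ->
  exists E' (j : {linear X -> E'}) (l : {linear E' -> E}) (q : {linear E' -> C'}),
  [/\ short_exact j q, forall x, l (j x) = i x, forall e, h (q e) = p (l e)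
    & forall c e, h c = p e -> exists e', l e' = e /\ q e' = c].
Proof.
move=> ex; case: (ex) => ii ip sp.
have [E' [l [q [pl ph lq0]]]] := pullback p h.
have lq : injective (pair_lin l q).
  by apply: ker_inj => e [e1 e2]; exact: lq0.
have [x|j jE] := factor_inj (h := pair_lin i (zero_lin X C')) lq.
  have [|e [le qe]] := ph (i x) 0; first by rewrite linear0 short_exact_comp0.
  by exists e; rewrite /= le qe.
have lj x : l (j x) = i x by case: (jE x).
have qj x : q (j x) = 0 by case: (jE x).
exists E', j, l, q; split=> //; last first.
  by move=> c e e1; have [e' [? ?]] := ph e c (esym e1); exists e'.
split=> [x y e|e|c].
- by apply: ii; rewrite -!lj e.
- split=> [qe|[x <-]] //.
  have /ip[x xE] : p (l e) = 0 by rewrite pl qe linear0.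
  by exists x; apply: lq; congr (_, _); rewrite /= ?lj // qj qe.
- have [e pe] := sp (h c); have [e' [_ <-]] := ph _ _ pe; by exists e'.
Qed.

(** The pushout along [h] is an extension of [C] by [X]; its retraction, composed with the map from
    [E], is the required extension of [h]. *)
Lemma ext_extend K E C X (i : {linear K -> E}) (p : {linear E -> C}) (h : {linear K -> X}) :
  short_exact i p -> ext_split C X ->
  exists k : {linear E -> X}, forall u, k (i u) = h u.
Proof.
move=> ex sCX; have [Q [j [l [q [exQ li ql _ _]]]]] := pushout_exact h ex.
have [r rj] := section_retraction exQ (sCX _ _ _ exQ).
by exists (comp_lin r l) => u; rewrite /comp_lin /= li rj.
Qed.

Lemma ext_lift K E C X (i : {linear K -> E}) (p : {linear E -> C}) (h : {linear X -> C}) :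
  short_exact i p -> ext_split X K ->
  exists k : {linear X -> E}, forall u, p (k u) = h u.
Proof.
move=> ex sXK; have [Q [j [l [q [exQ lj hq _]]]]] := pullback_exact h ex.
have [s qs] := sXK _ _ _ exQ.
by exists (comp_lin l s) => u; rewrite /comp_lin /= -hq qs.
Qed.

(** The map [p] lifts to [l : P -> E] by projectivity, and on [K] the lift takes values in [X].
    Subtracting an extension to [P] of that restriction makes the lift vanish on [K], so it descends
    to a section. *)
Lemma ext_of_projective P K C X (i : {linear K -> P}) (p : {linear P -> C}) :
  projective P -> short_exact i p ->
  (forall h : {linear K -> X}, exists k : {linear P -> X}, forall u, k (i u) = h u) ->
  ext_split C X.
Proof.
move=> pP [ii ip sp] eP E a b exE; case: (exE) => ia ab sb.
have [l bl] := pP _ _ b p sb.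
have [u|h hE] := factor_inj (h := comp_lin l i) ia.
  by apply/ab; rewrite /comp_lin /= bl; apply/ip; exists u.
have [k kE] := eP h.
have [x|s sE] := factor_surj (h := sub_lin l (comp_lin a k)) sp.
  by move=> /ip[u <-]; rewrite /= kE hE subrr.
exists s => c; have [x <-] := sp c.
by rewrite sE /= linearB bl (short_exact_comp0 _ exE) subr0.
Qed.

Lemma Ext1_eq0P C X : Ext1_eq0 C X <-> ext_split C X.
Proof.
split=> [e0|sCX P h hd].
  pose P := free_resolution C; pose p := res_aug P.
  have exp : short_exact (ker_lin p) p := short_exact_ker (@res_surj _ _ P).
  apply: (ext_of_projective (X := X) (@res_proj _ _ P 0) exp).
  (* [d] is the first differential with target cut down to the kernel of the augmentation; a map [h]
     on that kernel yields the cocycle h ∘ d, and a bounding map for it extends [h]. *)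
  move=> h; have [z|d dE] := factor_inj (h := res_d P 0) (@ker_lin_inj _ _ _ p).
    by apply/ker_linP/res_exact0; exists z.
  have [z|k kE] := e0 P (comp_lin h d).
    have d0 : d (res_d P 1 z) = 0.
      by apply: (@ker_lin_inj _ _ _ p); rewrite dE linear0; apply/res_exact; exists z.
    by rewrite /comp_lin /= d0 linear0.
  exists k => u; have /res_exact0[z zE] : p (ker_lin p u) = 0 by exact: ker_linK.
  by rewrite -zE -kE /comp_lin /=; congr (h _); apply: (@ker_lin_inj _ _ _ p); rewrite dE.
(* Conversely, for any resolution, a cocycle vanishes on the kernel of [d], so it comes from a map
   on the kernel of the augmentation, which extends by [ext_extend]. *)
pose p := res_aug P.
have [z|d dE] := factor_inj (h := res_d P 0) (@ker_lin_inj _ _ _ p).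
  by apply/ker_linP/res_exact0; exists z.
have sd : surj d.
  move=> u; have /res_exact0[z zE] : p (ker_lin p u) = 0 by exact: ker_linK.
  by exists z; apply: (@ker_lin_inj _ _ _ p); rewrite dE.
have [z dz|h' h'E] := factor_surj (h := h) sd.
  have /res_exact[w <-] : res_d P 0 z = 0 by rewrite -dE dz linear0.
  exact: hd.
have [k kE] := ext_extend h' (short_exact_ker (f := p) (@res_surj _ _ P)) sCX.
by exists k => z; rewrite -dE kE h'E.
Qed.

Lemma projective_ext P X : projective P -> ext_split P X.
Proof. by move=> pP E i p [_ _ sp]; exact: (pP _ _ p (id_lin P) sp). Qed.

Lemma iso_sym U V : iso U V -> iso V U.
Proof.
move=> [h [g hg gh]].
have lg : linear g by move=> r x y; apply: (can_inj hg); rewrite linearP !gh.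
by exists (mklin lg); exists h.
Qed.

Lemma iso_refl U : iso U U.
Proof. by exists (id_lin U); exists id. Qed.

Lemma bij_lin_inv U V (h : {linear U -> V}) : bijective h ->
  exists g : {linear V -> U}, cancel h g /\ cancel g h.
Proof.
move=> [g hg gh].
have lg : linear g by move=> r x y; apply: (can_inj hg); rewrite linearP !gh.
by exists (mklin lg).
Qed.

Lemma bij_of U V (h : {linear U -> V}) : injective h -> surj h -> bijective h.
Proof.
move=> ih sh; pose g v := projT1 (cid (sh v)).
have gh v : h (g v) = v by rewrite /g; case: cid.
by exists g => // u; apply: ih.
Qed.

Lemma short_exact_iso X X' E C C' (i : {linear X -> E}) (p : {linear E -> C})
    (a : {linear X' -> X}) (b : {linear C -> C'}) : bijective a -> bijective b ->
  short_exact i p -> short_exact (comp_lin i a) (comp_lin b p).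
Proof.
move=> [a' aa a'a] [b' bb b'b] ex; have [ii ip sp] := ex; split=> [|e|c] /=.
- by move=> x y /ii/(can_inj aa).
- split=> [be|[x <-]]; rewrite /comp_lin /=.
    have /ip[x <-] : p e = 0 by apply: (can_inj bb); rewrite linear0.
    by exists (a' x); rewrite /comp_lin /= a'a.
  by rewrite (short_exact_comp0 _ ex) linear0.
- by have [e eE] := sp (b' c); exists e; rewrite /comp_lin /= eE.
Qed.

Lemma short_exact_mid K E E' C (i : {linear K -> E})
    (p : {linear E -> C}) (m : {linear E -> E'}) (m' : {linear E' -> E}) :
  cancel m m' -> cancel m' m -> short_exact i p ->
  short_exact (comp_lin m i) (comp_lin p m').
Proof.
move=> mK m'K [ii ip sp]; split=> [|e|x].
- exact: (inj_comp (can_inj mK) ii).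
- rewrite comp_linE; split=> [/ip[u uE]|[u <-]].
    by exists u; rewrite comp_linE uE m'K.
  by rewrite comp_linE mK; apply/ip; exists u.
- by have [e <-] := sp x; exists (m e); rewrite comp_linE mK.
Qed.

Lemma ext_split_iso C C' X X' : iso C C' -> iso X X' -> ext_split C X -> ext_split C' X'.
Proof.
move=> iC iX sCX E i p ex.
have [h bh] := iX; have [k bk] := iso_sym iC.
have [s sE] := sCX _ _ _ (short_exact_iso bh bk ex).
have [k' [kk k'k]] := bij_lin_inv bk.
by exists (comp_lin s k) => c; apply: (can_inj kk); rewrite /comp_lin /= [LHS]sE.
Qed.

(** Since Ext(C1, X) vanishes, [i] lifts to t : C1 -> E. The quotient of [E] by the image of t is an
    extension of [C2] by [X]; its retraction, composed with the projection, is a retraction of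
    [a]. *)
Lemma ext_split_extl C1 C C2 X (i : {linear C1 -> C}) (p : {linear C -> C2}) :
  short_exact i p -> ext_split C1 X -> ext_split C2 X -> ext_split C X.
Proof.
move=> exC s1 s2 E a b exE; apply: (retraction_section exE).
have [ia ab sb] := exE; have [ii ip sp] := exC.
have [t tE] := ext_lift i exE s1.
have it : injective t by move=> x y e; apply: ii; rewrite -!tE e.
pose q := coker_lin t.
have qa_inj : injective (comp_lin q a).
  apply: ker_inj => x /coker_linP[c cE].
  have := tE c; rewrite cE (short_exact_comp0 _ exE) => /esym/(inj_ker ii) c0.
  by apply: (inj_ker ia); rewrite -cE c0 linear0.
have [e|g gE] := factor_surj (h := comp_lin p b) (@coker_lin_surj _ _ _ t).
  by move=> /coker_linP[c <-]; rewrite /comp_lin /= tE (short_exact_comp0 _ exC).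
have exQ : short_exact (comp_lin q a) g.
  split=> // [e|c]; last first.
    by have [y yE] := sp c; have [e eE] := sb y; exists (q e); rewrite gE -yE -eE.
  have [e' <-] := @coker_lin_surj _ _ _ t e; rewrite gE; split.
    move=> /ip[c cE]; have /ab[x xE] : b (e' - t c) = 0.
      by rewrite linearB tE cE subrr.
    exists x; change (q (a x) = q e'); rewrite xE linearB.
    have /coker_linP q0 : exists u, t u = t c by exists c.
    by rewrite [q (t c)]q0 subr0.
  move=> [x xE]; rewrite -gE -/q -xE gE /comp_lin /= (short_exact_comp0 _ exE).
  exact: linear0.
have [r rE] := section_retraction exQ (s2 _ _ _ exQ).
by exists (comp_lin r q) => x; exact: rE.
Qed.

End Extensions.

(** * Cotorsion pairs *)

Section CotorsionPairs.
Variable R : pzRingType.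
Implicit Types C D E K P U V W X Z : lmodType R.
Variables CC DD : mod_class R.

Lemma rperpP X : rperp CC X <-> forall C, CC C -> ext_split C X.
Proof. by split=> h C hC; apply/Ext1_eq0P; exact: h. Qed.

Lemma lperpP X : lperp DD X <-> forall D, DD D -> ext_split X D.
Proof. by split=> h C hC; apply/Ext1_eq0P; exact: h. Qed.

Lemma rperp_iso U V : iso U V -> rperp CC U -> rperp CC V.
Proof.
move=> i /rperpP h; apply/rperpP => C hC.
exact: (ext_split_iso (iso_refl C) i (h _ hC)).
Qed.

Lemma lperp_iso U V : iso U V -> lperp DD U -> lperp DD V.
Proof.
move=> i /lperpP h; apply/lperpP => D hD.
exact: (ext_split_iso i (iso_refl D) (h _ hD)).
Qed.

Lemma lperp_ext U V W (i : {linear U -> V}) (p : {linear V -> W}) :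
  short_exact i p -> lperp DD U -> lperp DD W -> lperp DD V.
Proof.
move=> ex /lperpP hU /lperpP hW; apply/lperpP => D hD.
exact: (ext_split_extl ex (hU _ hD) (hW _ hD)).
Qed.

Hypothesis hCD : cotorsion_pair CC DD.

Lemma cotorsion_ext C D : CC C -> DD D -> ext_split C D.
Proof. by move=> hC /(proj1 hCD)/rperpP; apply. Qed.

Lemma cotorsion_leftP C : CC C <-> forall D, DD D -> ext_split C D.
Proof. by rewrite -(proj2 hCD); exact: lperpP. Qed.

Lemma cotorsion_rightP D : DD D <-> forall C, CC C -> ext_split C D.
Proof. by rewrite -(proj1 hCD); exact: rperpP. Qed.

Lemma cotorsion_left_iso U V : iso U V -> CC U -> CC V.
Proof. by move=> i /(proj2 hCD) h; apply/(proj2 hCD); exact: lperp_iso h. Qed.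

Lemma cotorsion_right_iso U V : iso U V -> DD U -> DD V.
Proof. by move=> i /(proj1 hCD) h; apply/(proj1 hCD); exact: rperp_iso h. Qed.

Lemma cotorsion_left_extension U V W (i : {linear U -> V}) (p : {linear V -> W}) :
  short_exact i p -> CC U -> CC W -> CC V.
Proof.
by move=> ex /(proj2 hCD) hU /(proj2 hCD) hW; apply/(proj2 hCD); exact: lperp_ext ex hU hW.
Qed.

(** The cokernel of the composite is an extension of [C'] by [C]. *)
Lemma cotorsion_left_compose (E0 E1 E2 C C' : lmodType R) (i : {linear E0 -> E1})
    (p : {linear E1 -> C}) (i' : {linear E1 -> E2}) (p' : {linear E2 -> C'}) :
  short_exact i p -> short_exact i' p' -> CC C -> CC C' ->
  exists (C'' : lmodType R) (p'' : {linear E2 -> C''}), CC C'' /\ short_exact (comp_lin i' i) p''.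
Proof.
move=> ex ex' hC hC'; have [ii ip sp] := ex; have [ii' ip' sp'] := ex'.
have exc := short_exact_coker (inj_comp ii' ii : injective (comp_lin i' i)).
have [_ ic _] := exc; set k := coker_lin _ in exc ic.
exists (coker (comp_lin i' i)), k; split=> //.
have [x|a aE] := factor_surj (h := comp_lin k i') sp.
  by move=> /ip[u <-]; exact: (short_exact_comp0 u exc).
have [x|b bE] := factor_surj (h := p') (@coker_lin_surj _ _ _ (comp_lin i' i)).
  by move=> /coker_linP[u <-]; rewrite comp_linE (short_exact_comp0 _ ex').
apply: (cotorsion_left_extension (i := a) (p := b)) => //; split=> [|y|y].
- apply: ker_inj => z; have [x <-] := sp z; rewrite aE comp_linE => /ic[u].
  by rewrite comp_linE => /ii' <-; rewrite (short_exact_comp0 _ ex).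
- have [x <-] := coker_lin_surj y; rewrite bE; split=> [/ip'[z <-]|[z]].
    by exists (p z); rewrite aE.
  have [w <-] := sp z; rewrite aE comp_linE -bE => <-.
  by rewrite bE (short_exact_comp0 _ ex').
- by have [x <-] := sp' y; exists (k x); rewrite bE.
Qed.

Lemma cotorsion_projective P : projective P -> CC P.
Proof. by move=> pP; apply/cotorsion_leftP => D _; exact: projective_ext. Qed.

(* Salce's lemma, using that there are enough projectives. *)
Lemma complete_of_right :
  (forall Z, exists D C (i : {linear Z -> D}) (p : {linear D -> C}),
     [/\ CC C, DD D & short_exact i p]) -> complete_pair CC DD.
Proof.
move=> env Z; split; last exact: env.
pose p := cover_map Z; have ex : short_exact (ker_lin p) p.
  exact/short_exact_ker/cover_map_surj.
have [D [C [i [q [hC hD exK]]]]] := env (ker p).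
have [E [j [l [z [exE li zl jl jl0]]]]] := pushout_exact i ex.
have [ii iq sq] := exK.
have sjl : surj (copair_lin j l).
  by move=> e; have [x [v ->]] := jl e; exists (x, v).
have [[x e]|c cE] := factor_surj (h := comp_lin q (fst_lin D (cover Z))) sjl.
  by move=> /= /jl0[u _ ->]; rewrite linearN (short_exact_comp0 _ exK) oppr0.
have cj x : c (j x) = q x.
  by have := cE (x, 0); rewrite /= linear0 addr0.
have cl e : c (l e) = 0.
  by have := cE (0, e); rewrite /= linear0 add0r => ->; exact: linear0.
(* The other row of the pushout square: [E] is an extension of [C] by the cover of [Z], and both lie
   in the left class. *)
have exl : short_exact l c.
  split=> [|e|y]; last by have [x <-] := sq y; exists (j x).
    apply: ker_inj => e le; have /jl0[u -> /eqP] : j 0 + l e = 0 by rewrite linear0 add0r.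
    by rewrite eq_sym oppr_eq0 => /eqP/(inj_ker ii) ->; exact: linear0.
  split=> [|[x <-]] //; have [x [v ->]] := jl e.
  rewrite linearD cj cl addr0 => /iq[u <-]; exists (ker_lin p u + v).
  by rewrite linearD li.
exists D, E, j, z; split=> //; apply: cotorsion_left_extension exl _ hC.
exact/cotorsion_projective/free_mod_projective.
Qed.

(* Dimension shift: for C in CC and 0 -> K -> P -> C -> 0 with P projective, K is in CC,
   so a map K -> coker i lifts to V and the lift extends to P. *)
Lemma hereditary_of_left :
  (forall V W (p : {linear V -> W}), CC V -> CC W -> surj p -> CC (ker p)) ->
  hereditary_pair CC DD.
Proof.
move=> hk; split=> // U V i hU hV ii; apply/cotorsion_rightP => C hC.
have pP : projective (cover C) by exact: free_mod_projective.
have ex := short_exact_ker (@cover_map_surj _ C).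
apply: (ext_of_projective (X := coker i) pP ex) => h.
have hK : CC (ker (cover_map C)).
  apply: hk => //; [exact: cotorsion_projective|exact: cover_map_surj].
have [k kE] := ext_lift h (short_exact_coker ii) (cotorsion_ext hK hU).
have [k' k'E] := ext_extend k ex (cotorsion_ext hC hV).
by exists (comp_lin (coker_lin i) k') => u; rewrite -kE -k'E.
Qed.

Lemma hereditary_left_exact U V W (i : {linear U -> V}) (p : {linear V -> W}) :
  hereditary_pair CC DD -> short_exact i p -> CC V -> CC W -> CC U.
Proof.
move=> [hk _] ex hV hW; have [ii ip sp] := ex.
apply: cotorsion_left_iso (hk _ _ p hV hW sp).
have [u|h hE] := factor_inj (h := i) (@ker_lin_inj _ _ _ p).
  by apply/ker_linP; exact: short_exact_comp0 ex.
apply: iso_sym; exists h; apply: bij_of.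
  by move=> x y e; apply: ii; rewrite -!hE e.
move=> k; have /ip[u uE] := ker_linK k.
by exists u; apply: (@ker_lin_inj _ _ _ p); rewrite hE.
Qed.

End CotorsionPairs.

(** * Right exactness of the tensor product, and Tor *)

Section TensorExact.
Variables (R S : pzRingType) (N : bimodType R S).
Implicit Types (X Y F K W : lmodType S).

Lemma tensor_univ X (W : lmodType R) (b : N -> X -> W) : balanced b ->
  (forall r n x, b (r *: n) x = r *: b n x) ->
  exists L : {linear tensor N X -> W}, forall n x, L (tens n x) = b n x.
Proof.
move=> bal bZ; pose L := tensor_lift b.
have LD : {morph L : t u / t + u} := tensor_liftD bal.
have LE n x : L (tens n x) = b n x := tensor_lift_tens bal n x.
have L0 : L 0 = 0 by apply: (addrI (L 0)); rewrite -LD !addr0.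
have lL : linear L.
  move=> r t u; rewrite LD; congr (_ + _).
  elim/tensor_ind: t => [|n x t IH]; first by rewrite scaler0 L0 scaler0.
  by rewrite scalerDr !LD IH scale_tens !LE bZ scalerDr.
by exists (mklin lL).
Qed.

Lemma tensor_ext X (W : lmodType R) (f g : {linear tensor N X -> W}) :
  (forall n x, f (tens n x) = g (tens n x)) -> f =1 g.
Proof.
by move=> e; elim/tensor_ind=> [|n x t IH]; rewrite ?linear0 // !linearD IH e.
Qed.

Lemma tensor_map_comp X Y W (g : {linear Y -> W}) (f : {linear X -> Y}) t :
  tensor_map N g (tensor_map N f t) = tensor_map N (comp_lin g f) t.
Proof.
apply: (tensor_ext (f := comp_lin (tensor_map N g) (tensor_map N f))) t => n x.
by rewrite !comp_linE /= !tensor_map_tens.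
Qed.

Lemma eq_tensor_map X Y (f g : {linear X -> Y}) : f =1 g ->
  tensor_map N f =1 tensor_map N g.
Proof. by move=> e; apply: tensor_ext => n x; rewrite /= !tensor_map_tens e. Qed.

Lemma tensor_map_id X (f : {linear X -> X}) : f =1 id -> tensor_map N f =1 id.
Proof.
move=> e; apply: (tensor_ext (g := id_lin _)) => n x.
by rewrite /= tensor_map_tens e.
Qed.

Lemma tensor_map0 X Y (f : {linear X -> Y}) : (forall x, f x = 0) ->
  forall t, tensor_map N f t = 0.
Proof.
move=> e; apply: (tensor_ext (g := zero_lin _ _)) => n x.
by rewrite /= tensor_map_tens e; apply: (addrI (tens n 0)); rewrite -tensDr !addr0.
Qed.

Lemma tensor_map_surj X Y (f : {linear X -> Y}) : surj f -> surj (tensor_map N f).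
Proof.
move=> sf; elim/tensor_ind=> [|n y t [u <-]]; first by exists 0; exact: linear0.
have [x <-] := sf y; exists (tens n x + u).
by rewrite linearD /= tensor_map_tens.
Qed.

(** An inverse to the map from the cokernel of N ⊗ i to N ⊗ Y sends n ⊗ y to the class of n ⊗ s y,
    for a set-theoretic section s of [p]. The class does not depend on s, which makes the assignment
    balanced. *)
Lemma tensor_right_exact K X Y (i : {linear K -> X}) (p : {linear X -> Y}) :
  exact_at i p -> surj p -> exact_at (tensor_map N i) (tensor_map N p).
Proof.
move=> ip sp t; split=> [pt|[s <-]]; last first.
  by rewrite tensor_map_comp tensor_map0 // => x; apply/ip; exists x.
apply/coker_linP; pose q := coker_lin (tensor_map N i).
have qE n x x' : p x = p x' -> q (tens n x) = q (tens n x').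
  move=> e; have /ip[k kE] : p (x - x') = 0 by rewrite linearB e subrr.
  rewrite -[x](subrK x') tensDr linearD -kE.
  have /coker_linP -> : exists s, tensor_map N i s = tens n (i k).
    by exists (tens n k); exact: tensor_map_tens.
  exact: add0r.
pose s y := projT1 (cid (sp y)).
have ps y : p (s y) = y by rewrite /s; case: cid.
have bal : balanced (fun n y => q (tens n (s y))).
  split=> [n n' y|n y y'|n r y].
  - by rewrite tensDl linearD.
  - by rewrite -linearD -tensDr; apply: qE; rewrite linearD !ps.
  - by rewrite tensS; apply: qE; rewrite linearZ !ps.
have [r n y|L LE] := tensor_univ bal; first by rewrite -scale_tens linearZ.
suff LpE : L (tensor_map N p t) = q t by rewrite -[LHS]LpE pt linear0.
move: t {pt}; apply: (tensor_ext (f := comp_lin L (tensor_map N p))) => n x.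
by rewrite comp_linE /= tensor_map_tens LE; apply: qE; rewrite ps.
Qed.

(* With P -> W a surjection from a projective lifted to P -> F, the sequence
   0 -> ker (P -> W) -> P x K -> F -> 0 is exact. *)
Lemma Tor1_eq0_inj K F W (i : {linear K -> F}) (p : {linear F -> W}) :
  Tor1_eq0 N W -> short_exact i p -> injective (tensor_map N i).
Proof.
move=> tor ex; pose P := free_resolution W; pose a := cover_map W.
(* Lift t to the cover of the kernel. Vanishing of Tor places the lift in the image of the next
   differential, which dies in N ⊗ ker a. *)
have ia : injective (tensor_map N (ker_lin a)).
  apply: ker_inj => t e.
  have sd : surj (cover_map (ker a)) := @cover_map_surj _ _.
  have [s sE] := tensor_map_surj sd t.
  have /tor[w wE] : tensor_map N (res_d P 0) s = 0.
    by rewrite -tensor_map_comp sE.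
  rewrite -sE -wE tensor_map_comp tensor_map0 // => x.
  exact: (ker_linK (f := cover_map (ker a))).
have [ii ip sp] := ex.
have [l lE] := free_mod_projective (K := W) a sp.
have [u|k kE] := factor_inj (h := comp_lin l (ker_lin a)) ii.
  by apply/ip; rewrite /comp_lin /= lE; exact: ker_linK.
pose j := pair_lin (ker_lin a) (sub_lin (zero_lin _ _) k).
pose m := copair_lin l i.
have sm : surj m.
  move=> f; have [x xE] := @cover_map_surj _ W (p f).
  have /ip[y yE] : p (f - l x) = 0 by rewrite linearB lE xE subrr.
  by exists (x, y); rewrite /= yE addrC subrK.
have jm : exact_at j m.
  move=> [x y]; split=> [/eqP|[u [<- <-]]] /=; last first.
    by rewrite sub0r linearN kE subrr.
  rewrite addr_eq0 => /eqP lx.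
  have /ker_linP[u uE] : a x = 0.
    by rewrite -lE lx linearN (short_exact_comp0 _ ex) oppr0.
  exists u; congr (_, _) => //; apply: ii.
  by rewrite /= sub0r linearN kE comp_linE uE lx opprK.
apply: ker_inj => t it.
(* Placed in the second summand, t is killed by N ⊗ m, so it comes from some s in N ⊗ ker a. The
   first component of its image is zero, hence s = 0 by [ia]. *)
pose inr := pair_lin (zero_lin K (cover W)) (id_lin K).
have /(tensor_right_exact jm sm)[s sE] : tensor_map N m (tensor_map N inr t) = 0.
  rewrite tensor_map_comp -it; apply: eq_tensor_map => x.
  by rewrite comp_linE /= linear0 add0r.
have s0 : s = 0.
  apply: (inj_ker ia).
  transitivity (tensor_map N (comp_lin (fst_lin _ _) j) s); first exact: eq_tensor_map.
  by rewrite -tensor_map_comp sE tensor_map_comp tensor_map0.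
have := tensor_map_comp (snd_lin (cover W) K) inr t.
by rewrite -sE s0 !linear0 tensor_map_id.
Qed.

End TensorExact.

(** * Character modules *)

(** The generator is the least positive element, or 0 when there is none. *)
Lemma int_subgroup (P : int -> Prop) : P 0 -> (forall m n, P m -> P n -> P (m - n)) ->
  exists k : nat, forall n, P n <-> (k %| n)%Z.
Proof.
move=> P0 PB.
have PN n : P n -> P (- n) by move=> Pn; rewrite -sub0r; exact: PB.
have PD m n : P m -> P n -> P (m + n) by move=> Pm Pn; rewrite -[n]opprK; apply/PB/PN.
have PMn m n : P m -> P (m *+ n).
  by move=> Pm; elim: n => // n IH; rewrite mulrS; exact: PD.
have PM m n : P m -> P (n * m).
  by move=> Pm; case: n => n; rewrite ?NegzE ?mulNr; last apply: PN;
     rewrite mulrC -[Posz _]natz mulr_natr; exact: PMn.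
have [ex|nex] := pselect (exists k : nat, (0 < k)%N && `[< P k >]); last first.
  exists 0%N => n; rewrite dvd0z; split=> [Pn|/eqP -> //]; apply/negPn/negP => n0; case: nex.
  exists `|n|%N; rewrite absz_gt0 n0; apply/asboolP.
  by case: (intP n) Pn => // m; rewrite ?abszN //=; move/PN; rewrite opprK.
case: (ex_minnP ex) => k /andP[k0 /asboolP Pk] kmin; exists k => n; split=> [Pn|/dvdzP[m ->]].
  apply/dvdz_mod0P.
  have Pr : P (n %% k)%Z.
    have -> : (n %% k)%Z = n - (n %/ k)%Z * k by rewrite [X in _ = X - _](divz_eq n k) addrC addKr.
    by apply: PB => //; exact: PM.
  have: (n %% k)%Z < k%:Z by rewrite ltz_pmod.
  have: 0 <= (n %% k)%Z by rewrite modz_ge0 //; case: (k) k0.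
  case: (n %% k)%Z Pr => // [[|r]] // Pr _; rewrite ltz_nat => rk.
  by have := kmin r.+1; rewrite /= leqNgt rk => h; case: (negP (h _)) => //; apply/asboolP.
exact: PM.
Qed.

(** * Extending homomorphisms into divisible groups *)

Section DivisibleExtension.
Local Open Scope classical_set_scope.
Variables P D : zmodType.
Hypothesis divD : forall (d : D) (n : nat), (0 < n)%N -> exists d', d' *+ n = d.

(** Graphs of homomorphisms from subgroups of [P] to [D]; the last clause is single-valuedness at
    0. *)
Let sub_hom (G : set (P * D)) :=
  [/\ G (0, 0), forall u v, G u -> G v -> G (u - v) & forall d, G (0, d) -> d = 0].

(** Baer's argument: a maximal graph over [G0] is defined everywhere, since otherwise one more
    element could be adjoined to its domain. *)
Lemma divisible_extension (G0 : set (P * D)) : sub_hom G0 ->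
  exists F : {additive P -> D}, forall x d, G0 (x, d) -> F x = d.
Proof.
move=> hG0.
(* The chain may be empty, with empty union; taking the union with [G0] inside the predicate covers
   this case. *)
have [F FP tF|A [hA maxA]] := @Zorn_bigcup _ (fun A => sub_hom (A `|` G0)).
  split=> [|u v|d].
  - by right; case: hG0.
  - have step B : F B \/ B = G0 -> (B `|` G0) u -> (B `|` G0) v -> (B `|` G0) (u - v).
      by move=> [/FP[_ h _]|->]; [exact: h|rewrite setUid; case: hG0 => _ h _; exact: h].
    move=> [[B FB Bu]|G0u] [[B' FB' B'v]|G0v].
    + have [BB|BB] := tF _ _ FB FB'.
        have [|G0uv] := step B' (or_introl FB') (or_introl (BB _ Bu)) (or_introl B'v).
          by left; exists B'.
        by right.
      have [|G0uv] := step B (or_introl FB) (or_introl Bu) (or_introl (BB _ B'v)).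
        by left; exists B.
      by right.
    + have [|G0uv] := step B (or_introl FB) (or_introl Bu) (or_intror G0v).
        by left; exists B.
      by right.
    + have [|G0uv] := step B' (or_introl FB') (or_intror G0u) (or_introl B'v).
        by left; exists B'.
      by right.
    + by right; case: hG0 => _ h _; exact: h.
  - by move=> [[B /FP[_ _ h] Bd]|]; [apply: h; left|case: hG0 => _ _ h; exact: h].
pose G := A `|` G0.
have [G00 GB Gf] := hA.
have GN x d : G (x, d) -> G (- x, - d).
  by move=> h; have := GB _ _ G00 h; congr (G (_, _)); rewrite /= sub0r.
have GD x d x' d' : G (x, d) -> G (x', d') -> G (x + x', d + d').
  by move=> h /GN h'; have := GB _ _ h h'; congr (G (_, _)); rewrite /= opprK.
have GMn x d n : G (x, d) -> G (x *+ n, d *+ n).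
  by move=> h; elim: n => // n IH; rewrite !mulrS; exact: GD.
have GM x d n : G (x, d) -> G (x *~ n, d *~ n).
  by move=> h; case: n => n; [exact: GMn|rewrite !NegzE !mulrNz; exact/GN/GMn].
have Gu x d d' : G (x, d) -> G (x, d') -> d = d'.
  move=> h h'; apply/eqP; rewrite -subr_eq0; apply/eqP/Gf.
  by have := GB _ _ h h'; congr (G (_, _)); rewrite /= subrr.
have tot x : exists d, G (x, d).
  (* The multiples of x in the domain correspond to kZ. The value at x has to be a k-th part of the
     value at kx: it exists by divisibility for k > 0 and is taken to be 0 for k = 0. *)
  have [k kP] : exists k : nat, forall n, (exists d, G (x *~ n, d)) <-> (k %| n)%Z.
    apply: int_subgroup; first by exists 0; rewrite mulr0z.
    move=> m n [d h] [d' h']; exists (d - d').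
    by have := GB _ _ h h'; rewrite mulrzBr.
  have [d0 hd0] : exists d, G (x *~ k, d) by apply/kP; exact: dvdzz.
  have [d dE] : exists d, d *+ k = d0.
    case: k {kP} hd0 => [|k] hd0; last exact: divD.
    by exists 0; rewrite (Gf d0) //; move: hd0; rewrite mulr0z.
  have dP n e : G (x *~ n, e) -> e = d *~ n.
    move=> h; have /dvdzP[m nE] : (k %| n)%Z by apply/kP; exists e.
    have := GM _ _ m hd0; rewrite -mulrzA mulrC -nE => h'.
    by rewrite (Gu _ _ _ h h') nE -dE pmulrn -mulrzA mulrC.
  exists d; pose G' : set (P * D) := fun u => exists v n, G v /\ u = v + (x *~ n, d *~ n).
  have GG' : G `<=` G' by move=> u hu; exists u, 0; split=> //; rewrite !mulr0z addr0.
  have hG' : sub_hom G'.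
    split.
    - exact/GG'.
    - move=> _ _ [u [m [hu ->]]] [v [n [hv ->]]]; exists (u - v), (m - n).
      split; first exact: GB.
      by rewrite !mulrzBr opprD addrACA.
    - move=> e [[y c] [n [hv [yE ->]]]].
      have -> : c = - (d *~ n).
        rewrite -mulrNz; apply: dP; rewrite mulrNz.
        by rewrite (_ : - _ = y) //; apply/eqP; rewrite eq_sym -addr_eq0 -yE.
      by rewrite addNr.
  have G'x : G' (x, d) by exists 0, 1; split=> //; rewrite add0r !mulr1z.
  have [G'A|nG'A] := pselect (G' `<=` A); first by left; exact: G'A.
  case: (maxA G'); first by split=> // u Au; apply: GG'; left.
  suff -> : G' `|` G0 = G' by [].
  by apply/setUidPl => u hu; apply: GG'; right.
have [F hF] := choice tot.
have FB : {morph F : x y / x - y}.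
  by move=> x y; apply: (Gu (x - y)) => //; have := GB _ _ (hF x) (hF y).
by exists (mkadditive FB) => x d h; apply: (Gu x) => //; right.
Qed.

End DivisibleExtension.

(** * The group Q/Z *)

Section RatModInt.

Let intr_linear : linear (fun n : int^o => n%:~R : zmodule rat).
Proof. by move=> r m n; rewrite intrD intrM scalezrE mulrzl. Qed.

Definition rat_mod_int : lmodType int := coker (mklin intr_linear).
Let proj : {linear zmodule rat -> rat_mod_int} := coker_lin _.

Lemma rat_mod_int_divisible (d : rat_mod_int) (n : nat) :
  (0 < n)%N -> exists d', d' *+ n = d.
Proof.
move=> n0; have [q <-] := coker_lin_surj d.
exists (proj ((q : rat) / n%:R : rat)); rewrite -raddfMn; congr (proj _).
rewrite -[LHS](mulr_natr ((q : rat) / n%:R : rat)); apply: divfK.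
by rewrite pnatr_eq0 -lt0n.
Qed.

Lemma rat_mod_int_torsion (k : nat) : k != 1%N ->
  exists q : rat_mod_int, q <> 0 /\ q *+ k = 0.
Proof.
(* The witness is the class of 1/k. For k = 0 the second condition is void and the class of 1/2
   serves. *)
move=> k1; pose c := (if k == 0 then 2 else k)%N.
have c1 : (1 < c)%N by rewrite /c; case: (k) k1 => [|[|]].
exists (proj (c%:R^-1 : rat)); split.
  move=> /coker_linP[m /= mE].
  have : (m * c)%:~R = 1 :> rat by rewrite intrM mE mulVf // pnatr_eq0; case: (c) c1.
  move/eqP; rewrite (eqr_int _ _ 1) => /eqP mc.
  have := congr1 absz mc; rewrite abszM /= => /eqP; rewrite muln_eq1 => /andP[_ /eqP cE].
  by rewrite cE in c1.
rewrite -raddfMn; apply/coker_linP.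
case: (eqVneq k 0%N) => [->|k0]; first by exists 0; rewrite mulr0n.
by exists 1; rewrite /= /c (negbTE k0) -[RHS](mulr_natr (_ : rat)) mulVf // pnatr_eq0.
Qed.

End RatModInt.

(** * The character module is injective and separates elements *)

Section Separation.
Local Open Scope classical_set_scope.
Variable R : pzRingType.

(* [R] as a bimodule over the integers and itself, so that [homMod] yields the
   character module Hom_Z(R, Q/Z). *)
Definition regI : Type := R.
HB.instance Definition _ := GRing.Lmodule.copy regI (zmodule R).
Let iA (m : regI) (s t : R) : (m : R) * s * t = m * (s * t) :> R. Proof. by rewrite mulrA. Qed.
Let i1 (m : regI) : (m : R) * 1 = m. Proof. exact: mulr1. Qed.
Let iDl (s : R) : {morph (fun m : regI => (m : R) * s : regI) : m m' / m + m'}.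
Proof. by move=> m m'; exact: mulrDl. Qed.
Let iDr (m : regI) : {morph (fun s : R => (m : R) * s : regI) : s t / s + t}.
Proof. by move=> s t; exact: mulrDr. Qed.
Let iS (r : int) (m : regI) (s : R) :
  r *: ((m : R) * s : regI) = ((r *: m : regI) : R) * s :> regI.
Proof. by rewrite scalezrE -mulrzAl. Qed.
HB.instance Definition _ := @Lmodule_isBimodule.Build int R regI
  (fun m s => (m : R) * s) iA i1 iDl iDr iS.

Definition char_mod : lmodType R := homMod regI rat_mod_int.

Section CharacterMap.
Variables (T : lmodType R) (F : {additive T -> rat_mod_int}).

Let char_fun_linear t : linear (fun r : regI => F ((r : R) *: t)).
Proof.
move=> z r s /=; rewrite (_ : z *: r + s = (r : R) *~ z + s :> R) //.
by rewrite scalerDl raddfD -scalerMzl raddfMz -scaler_int intz.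
Qed.
Let char_fun (t : T) : char_mod := mklin (char_fun_linear t).
Let char_fun_is_linear : linear char_fun.
Proof.
move=> r x y; apply: hom_ext => s.
by rewrite /hom_fun /= /hom_fun /= scalerDr raddfD scalerA.
Qed.

(** The linear map corresponding to the additive map [F] under the tensor-Hom adjunction; evaluation
    at 1 recovers [F]. *)
Definition char_lin : {linear T -> char_mod} := mklin char_fun_is_linear.

Lemma char_linE t (r : regI) : hom_fun (char_lin t) r = F ((r : R) *: t).
Proof. by []. Qed.

End CharacterMap.

(** Evaluation at 1 is an additive map on the submodule; divisibility of Q/Z extends it to [E], and
    its transpose [char_lin] is a retraction. *)
Lemma char_mod_injective C : ext_split C char_mod.
Proof.
move=> E i p ex; apply: (retraction_section ex); have [ii ip sp] := ex.
pose one : regI := (1 : R).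
pose G0 : set (E * rat_mod_int) := fun u => exists h : char_mod, u = (i h, hom_fun h one).
have [|F hF] := @divisible_extension E rat_mod_int rat_mod_int_divisible G0.
  split=> [|_ _ [h ->] [k ->]|d [h [/esym/(inj_ker ii) -> ->]]] //.
    by exists 0; rewrite linear0.
  by exists (h - k); rewrite linearB.
exists (char_lin F) => h; apply: hom_ext => r.
rewrite char_linE -linearZ (hF _ (hom_fun (r *: h : char_mod) one)); last by exists (r *: h).
by rewrite /hom_fun /= /hom_fun; congr (GRing.Linear.sort h _); exact: mul1r.
Qed.

(** With kZ the annihilator of t, the cyclic group generated by t maps to Q/Z by sending t to a
    nonzero q with k q = 0. The transpose of an extension of this map to [T] is nonzero at t. *)
Lemma char_mod_separates (T : lmodType R) (t : T) :
  t <> 0 -> exists h : {linear T -> char_mod}, h t <> 0.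
Proof.
move=> t0; have [k kP] : exists k : nat, forall n, t *~ n = 0 <-> (k %| n)%Z.
  apply: int_subgroup; first exact: mulr0z.
  by move=> m n e e'; rewrite mulrzBr e e' subrr.
have [|q [q0 qk]] := @rat_mod_int_torsion k.
  apply/eqP => k1; apply: t0; rewrite -[t]mulr1z; apply/kP; rewrite k1; exact: dvd1z.
pose G0 : set (T * rat_mod_int) := fun u => exists n, u = (t *~ n, q *~ n).
have [|F hF] := @divisible_extension T rat_mod_int rat_mod_int_divisible G0.
  split=> [|_ _ [m ->] [n ->]|d [n [/esym/kP/dvdzP[m ->] ->]]].
  - by exists 0; rewrite !mulr0z.
  - by exists (m - n); rewrite !mulrzBr.
  - by rewrite mulrC mulrzA -pmulrn qk mul0rz.
exists (char_lin F) => /(congr1 (fun h : char_mod => hom_fun h (1 : R))).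
rewrite char_linE scale1r (hF _ q) //; exists 1; by rewrite !mulr1z.
Qed.

End Separation.

(** * Modules over the Morita ring *)

Lemma tens0l (R S : pzRingType) (P : bimodType R S) (X : lmodType S) (x : X) :
  tens (0 : P) x = 0.
Proof. by apply: (addrI (tens 0 x)); rewrite -tensDl !addr0. Qed.

Lemma tens0r (R S : pzRingType) (P : bimodType R S) (X : lmodType S) (m : P) :
  tens m (0 : X) = 0.
Proof. by apply: (addrI (tens m 0)); rewrite -tensDr !addr0. Qed.

Lemma rscale0l (R S : pzRingType) (P : bimodType R S) (s : S) : rscale (0 : P) s = 0.
Proof. by apply: (addrI (rscale 0 s)); rewrite -rscaleDl !addr0. Qed.

Lemma rscale0r (R S : pzRingType) (P : bimodType R S) (m : P) : rscale m (0 : S) = 0.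
Proof. by apply: (addrI (rscale m 0)); rewrite -rscaleDr !addr0. Qed.

(** * From modules to quadruples: the corners of the two idempotents *)

Section Corners.
Variables (A B : pzRingType) (M : bimodType B A) (N : bimodType A B).
Variable c : morita_context M N.
Local Notation L := (morita_ring c).

Definition inA (a : A) : L := ((a, 0), (0, 0)).
Definition inB (b : B) : L := ((0, 0), (0, b)).
Definition inN (n : N) : L := ((0, n), (0, 0)).
Definition inM (m : M) : L := ((0, 0), (m, 0)).

Let eqL (a a' : A) (n n' : N) (m m' : M) (b b' : B) :
  a = a' -> n = n' -> m = m' -> b = b' -> ((a, n), (m, b)) = ((a', n'), (m', b')) :> L.
Proof. by move=> -> -> -> ->. Qed.

Let simp := (tens0l, tens0r, rscale0l, rscale0r, linear0, scaler0, scale0r,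
  mulr0, mul0r, addr0, add0r, @rscale1, scale1r, mulr1, mul1r).

Lemma inA_inA a a' : inA a * inA a' = inA (a * a').
Proof. by apply: eqL; rewrite /= ?simp. Qed.
Lemma inA_inN a n : inA a * inN n = inN (a *: n).
Proof. by apply: eqL; rewrite /= ?simp. Qed.
Lemma inN_inM n m : inN n * inM m = inA (mpsi c (tens n m)).
Proof. by apply: eqL; rewrite /= ?simp. Qed.
Lemma inN_inB n b : inN n * inB b = inN (rscale n b).
Proof. by apply: eqL; rewrite /= ?simp. Qed.
Lemma inM_inA m a : inM m * inA a = inM (rscale m a).
Proof. by apply: eqL; rewrite /= ?simp. Qed.
Lemma inM_inN m n : inM m * inN n = inB (mphi c (tens m n)).
Proof. by apply: eqL; rewrite /= ?simp. Qed.
Lemma inB_inM b m : inB b * inM m = inM (b *: m).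
Proof. by apply: eqL; rewrite /= ?simp. Qed.
Lemma inB_inB b b' : inB b * inB b' = inB (b * b').
Proof. by apply: eqL; rewrite /= ?simp. Qed.
Lemma inAD a a' : inA (a + a') = inA a + inA a'.
Proof. by apply: eqL; rewrite /= ?simp. Qed.
Lemma inBD b b' : inB (b + b') = inB b + inB b'.
Proof. by apply: eqL; rewrite /= ?simp. Qed.
Lemma inND n n' : inN (n + n') = inN n + inN n'.
Proof. by apply: eqL; rewrite /= ?simp. Qed.
Lemma inMD m m' : inM (m + m') = inM m + inM m'.
Proof. by apply: eqL; rewrite /= ?simp. Qed.
(** The first row of a matrix, each entry factored through the idempotent on its right. With the
    analogue for the second row, it makes the map to the pair of corners linear. *)
Lemma inA1_mul a n m b : inA 1 * ((a, n), (m, b)) = inA a * inA 1 + inN n * inB 1.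
Proof. by apply: eqL; rewrite /= ?simp. Qed.
Lemma inB1_mul a n m b : inB 1 * ((a, n), (m, b)) = inM m * inA 1 + inB b * inB 1.
Proof. by apply: eqL; rewrite /= ?simp. Qed.
Lemma inA1_inB1 : inA 1 + inB 1 = 1.
Proof. by apply: eqL; rewrite /= ?simp. Qed.
Lemma inA1_inB b : inA 1 * inB b = 0.
Proof. by apply: eqL; rewrite /= ?simp. Qed.
Lemma inB1_inA a : inB 1 * inA a = 0.
Proof. by apply: eqL; rewrite /= ?simp. Qed.

Variable W : lmodType L.

(** The corner e W of the idempotent e = [inA 1], encoded as the fixed points of e. *)
Definition upper_pred : pred W := fun w => inA 1 *: w == w.
Let upper_zmod : zmod_closed upper_pred.
Proof.
split=> [|u v /eqP hu /eqP hv]; apply/eqP; first exact: scaler0.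
by rewrite scalerBr hu hv.
Qed.
HB.instance Definition _ := GRing.isZmodClosed.Build W upper_pred upper_zmod.
Definition upper : Type := {w : W | w \in upper_pred}.
HB.instance Definition _ := SubChoice.on upper.
HB.instance Definition _ := [SubChoice_isSubZmodule of upper by <:].

Definition lower_pred : pred W := fun w => inB 1 *: w == w.
Let lower_zmod : zmod_closed lower_pred.
Proof.
split=> [|u v /eqP hu /eqP hv]; apply/eqP; first exact: scaler0.
by rewrite scalerBr hu hv.
Qed.
HB.instance Definition _ := GRing.isZmodClosed.Build W lower_pred lower_zmod.
Definition lower : Type := {w : W | w \in lower_pred}.
HB.instance Definition _ := SubChoice.on lower.
HB.instance Definition _ := [SubChoice_isSubZmodule of lower by <:].

Let mkupper w (h : w \in upper_pred) : upper := exist (fun w => w \in upper_pred) w h.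
Let mklower w (h : w \in lower_pred) : lower := exist (fun w => w \in lower_pred) w h.
Let upperP (l : L) w : inA 1 * l = l -> l *: w \in upper_pred.
Proof. by move=> e; apply/eqP; rewrite scalerA e. Qed.
Let lowerP (l : L) w : inB 1 * l = l -> l *: w \in lower_pred.
Proof. by move=> e; apply/eqP; rewrite scalerA e. Qed.
Let inA1A a : inA 1 * inA a = inA a. Proof. by rewrite inA_inA mul1r. Qed.
Let inA1N n : inA 1 * inN n = inN n. Proof. by rewrite inA_inN scale1r. Qed.
Let inB1B b : inB 1 * inB b = inB b. Proof. by rewrite inB_inB mul1r. Qed.
Let inB1M m : inB 1 * inM m = inM m. Proof. by rewrite inB_inM scale1r. Qed.

Definition upper_scale (a : A) (x : upper) : upper := mkupper (upperP (val x) (inA1A a)).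
Definition lower_scale (b : B) (y : lower) : lower := mklower (lowerP (val y) (inB1B b)).

Let uA a b v : upper_scale a (upper_scale b v) = upper_scale (a * b) v.
Proof. by apply: val_inj; rewrite /= scalerA inA_inA. Qed.
Let u1 : left_id 1 upper_scale.
Proof. by move=> v; apply: val_inj => /=; apply/eqP; exact: (valP v). Qed.
Let uDr : right_distributive upper_scale +%R.
Proof. by move=> a v w; apply: val_inj; exact: scalerDr. Qed.
Let uDl v : {morph upper_scale^~ v : a b / a + b}.
Proof. by move=> a b; apply: val_inj; rewrite /= inAD scalerDl. Qed.
HB.instance Definition _ := GRing.Zmodule_isLmodule.Build A upper uA u1 uDr uDl.

Let lA a b v : lower_scale a (lower_scale b v) = lower_scale (a * b) v.
Proof. by apply: val_inj; rewrite /= scalerA inB_inB. Qed.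
Let l1 : left_id 1 lower_scale.
Proof. by move=> v; apply: val_inj => /=; apply/eqP; exact: (valP v). Qed.
Let lDr : right_distributive lower_scale +%R.
Proof. by move=> a v w; apply: val_inj; exact: scalerDr. Qed.
Let lDl v : {morph lower_scale^~ v : a b / a + b}.
Proof. by move=> a b; apply: val_inj; rewrite /= inBD scalerDl. Qed.
HB.instance Definition _ := GRing.Zmodule_isLmodule.Build B lower lA l1 lDr lDl.

Let actM (m : M) (x : upper) : lower := mklower (lowerP (val x) (inB1M m)).
Let actN (n : N) (y : lower) : upper := mkupper (upperP (val y) (inA1N n)).

(** The two idempotents are orthogonal with sum 1, so W is the sum of its corners; [inM] and [inN]
    act between the corners and give f and g. *)
Lemma quad_exists : exists q : quad c, iso W (quad_mod q).
Proof.
have balM : balanced actM.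
  split=> [m m' x|m x x'|m s x]; apply: val_inj.
  - by rewrite /= inMD scalerDl.
  - exact: scalerDr.
  - by rewrite /= scalerA inM_inA.
have balN : balanced actN.
  split=> [m m' x|m x x'|m s x]; apply: val_inj.
  - by rewrite /= inND scalerDl.
  - exact: scalerDr.
  - by rewrite /= scalerA inN_inB.
have [r n x|f fE] := tensor_univ balM; first by apply: val_inj; rewrite /= scalerA inB_inM.
have [r n x|g gE] := tensor_univ balN; first by apply: val_inj; rewrite /= scalerA inA_inN.
have gf (n : N) (m : M) (x : upper) :
    g (tens n (f (tens m x))) = (mpsi c (tens n m) : A) *: x.
  by rewrite fE gE; apply: val_inj; rewrite /= scalerA inN_inM.
have fg (m : M) (n : N) (y : lower) :
    f (tens m (g (tens n y))) = (mphi c (tens m n) : B) *: y.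
  by rewrite fE gE; apply: val_inj; rewrite /= scalerA inM_inN.
pose q : quad c := Quad gf fg.
pose h (w : W) : quad_mod q :=
  (mkupper (upperP w (inA1A 1)) : upper, mklower (lowerP w (inB1B 1)) : lower).
have lh : linear h.
  move=> [[a n] [m b]] w w'; congr (_, _); apply: val_inj.
    change (inA 1 *: ((((a, n), (m, b)) : L) *: w + w') =
      inA a *: (inA 1 *: w) + val (g (tens n (h w).2)) + inA 1 *: w').
    by rewrite gE scalerDr scalerA inA1_mul scalerDl -!scalerA.
  change (inB 1 *: ((((a, n), (m, b)) : L) *: w + w') =
    val (f (tens m (h w).1)) + inB b *: (inB 1 *: w) + inB 1 *: w').
  by rewrite fE scalerDr scalerA inB1_mul scalerDl -!scalerA.
exists q, (mklin lh); exists (fun w => val w.1 + val w.2) => [w|[x y]] /=.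
  by rewrite -scalerDl inA1_inB1 scale1r.
have x1 := eqP (valP x); have y1 := eqP (valP y).
congr (_, _); apply: val_inj; rewrite /= scalerDr.
  by rewrite -y1 [X in _ + X]scalerA inA1_inB scale0r addr0 x1.
by rewrite -x1 scalerA inB1_inA scale0r add0r y1.
Qed.

End Corners.

(** * Morphisms and extensions of quadruples *)

Section QuadMaps.
Variables (A B : pzRingType) (M : bimodType B A) (N : bimodType A B).
Variable c : morita_context M N.
Local Notation L := (morita_ring c).
Implicit Types q e : quad c.

Lemma lmod_comp (l : L) q (w : quad_mod q) :
  l *: w = (l.1.1 *: w.1 + qg q (tens l.1.2 w.2), qf q (tens l.2.1 w.1) + l.2.2 *: w.2).
Proof. by case: l w => [[a n] [m b]] [x y]. Qed.

Section HomMap.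
Variables (Y Y' : lmodType B) (b : {linear Y -> Y'}).
Let hom_map_fun (h : homMod M Y) : homMod M Y' := comp_lin b h.
Let hom_map_linear : linear hom_map_fun.
Proof.
move=> r h k; apply: hom_ext => m.
by rewrite /hom_fun /= /hom_fun [LHS]linearD.
Qed.
Definition hom_map : {linear homMod M Y -> homMod M Y'} := mklin hom_map_linear.
Lemma hom_mapE h m : hom_fun (hom_map h) m = b (hom_fun h m).
Proof. by []. Qed.
End HomMap.

(** The adjoint of f. Morphisms and extensions are handled through it because the class [classN] is
    defined by its kernel and surjectivity. *)
Definition qh q : {linear qX q -> homMod M (qY q)} := adj (qf q).

Definition compat q e (a : {linear qX q -> qX e}) (b : {linear qY q -> qY e}) :=
  (forall x, hom_map b (qh q x) = qh e (a x)) /\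
  (forall t, a (qg q t) = qg e (tensor_map N b t)).

Lemma compatP q e (a : {linear qX q -> qX e}) (b : {linear qY q -> qY e}) :
  compat a b <-> (forall m x, b (qf q (tens m x)) = qf e (tens m (a x))) /\
                 (forall n y, a (qg q (tens n y)) = qg e (tens n (b y))).
Proof.
split=> -[h1 h2]; [split=> [m x|n y]|split=> [x|]].
- by have /(congr1 (fun h => hom_fun h m)) := h1 x.
- by rewrite h2 /= tensor_map_tens.
- by apply: hom_ext => m; exact: h1.
- apply: (tensor_ext (f := comp_lin a (qg q)) (g := comp_lin (qg e) (tensor_map N b))).
  by move=> n y; rewrite !comp_linE /= tensor_map_tens h2.
Qed.

Section QuadLin.
Variables (q e : quad c) (a : {linear qX q -> qX e}) (b : {linear qY q -> qY e}).
Hypothesis ab : compat a b.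
Let quad_lin_linear : linear (fun w : quad_mod q => (a w.1, b w.2) : quad_mod e).
Proof.
case/compatP: ab => abf abg l w w'; rewrite !lmod_comp.
by congr (_, _); rewrite /= !linearD /= linearZ ?abf ?abg.
Qed.
Definition quad_lin : {linear quad_mod q -> quad_mod e} := mklin quad_lin_linear.
Lemma quad_linE x y : quad_lin (x, y) = (a x, b y).
Proof. by []. Qed.
End QuadLin.

(** Commuting with the two idempotents makes [F] diagonal; commuting with the elements [inM m] and
    [inN n] gives compatibility. *)
Lemma quad_lin_inv q e (F : {linear quad_mod q -> quad_mod e}) :
  exists a b, @compat q e a b /\ forall x y, F (x, y) = (a x, b y).
Proof.
have ZA (q' : quad c) (r : A) (w : quad_mod q') : (inA c r : L) *: w = (r *: w.1, 0).
  by rewrite lmod_comp /= !tens0l !linear0 scale0r !addr0.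
have ZB (q' : quad c) (r : B) (w : quad_mod q') : (inB c r : L) *: w = (0, r *: w.2).
  by rewrite lmod_comp /= !tens0l !linear0 scale0r !add0r.
have ZM (q' : quad c) m (w : quad_mod q') : (inM c m : L) *: w = (0, qf q' (tens m w.1)).
  by rewrite lmod_comp /= !tens0l !linear0 !scale0r !addr0.
have ZN (q' : quad c) n (w : quad_mod q') : (inN c n : L) *: w = (qg q' (tens n w.2), 0).
  by rewrite lmod_comp /= !tens0l !linear0 !scale0r !add0r.
have F1 x : (F ((x, 0) : quad_mod q)).2 = 0.
  have -> : (x, 0) = (inA c 1 : L) *: ((x, 0) : quad_mod q) by rewrite ZA scale1r.
  by rewrite linearZ_LR ZA.
have F2 y : (F ((0, y) : quad_mod q)).1 = 0.
  have -> : (0, y) = (inB c 1 : L) *: ((0, y) : quad_mod q) by rewrite ZB scale1r.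
  by rewrite linearZ_LR ZB.
have la : linear (fun x => (F ((x, 0) : quad_mod q)).1).
  move=> r x x'.
  have -> : (r *: x + x', 0) = (inA c r : L) *: ((x, 0) : quad_mod q) + (x', 0).
    by rewrite ZA; congr (_, _); rewrite /= addr0.
  by rewrite linearD linearZ_LR ZA.
have lb : linear (fun y => (F ((0, y) : quad_mod q)).2).
  move=> r y y'.
  have -> : (0, r *: y + y') = (inB c r : L) *: ((0, y) : quad_mod q) + (0, y').
    by rewrite ZB; congr (_, _); rewrite /= addr0.
  by rewrite linearD linearZ_LR ZB.
exists (mklin la), (mklin lb); split.
  apply/compatP; split=> [m x|n y] /=.
    have -> : (0, qf q (tens m x)) = (inM c m : L) *: ((x, 0) : quad_mod q) by rewrite ZM.
    by rewrite linearZ_LR ZM.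
  have -> : (qg q (tens n y), 0) = (inN c n : L) *: ((0, y) : quad_mod q) by rewrite ZN.
  by rewrite linearZ_LR ZN.
move=> x y; have -> : (x, y) = ((x, 0) : quad_mod q) + (0, y).
  by congr (_, _); rewrite /= ?addr0 ?add0r.
rewrite linearD [LHS]surjective_pairing /= F1 F2.
by congr (_, _); rewrite /= ?addr0 ?add0r.
Qed.

Lemma quad_short_exact q e q' (a : {linear qX q -> qX e}) (b : {linear qY q -> qY e})
    (a' : {linear qX e -> qX q'}) (b' : {linear qY e -> qY q'})
    (ab : compat a b) (ab' : compat a' b') :
  short_exact (quad_lin ab) (quad_lin ab') <-> short_exact a a' /\ short_exact b b'.
Proof.
split=> [[i ip sp]|[[i1 ip1 sp1] [i2 ip2 sp2]]].
  split; split.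
  - by move=> x y e1; have [] : (x, 0) = (y, 0) :> quad_mod q by apply: i; rewrite !quad_linE e1.
  - move=> x; split=> [x0|[u <-]].
      have /ip[[u v] [<- _]] : quad_lin ab' (x, 0) = 0 by rewrite quad_linE x0 linear0.
      by exists u.
    have /ip : exists w, quad_lin ab w = (a u, 0) by exists (u, 0); rewrite quad_linE linear0.
    by case.
  - by move=> x; have [[u v] [<- _]] := sp (x, 0); exists u.
  - by move=> x y e1; have [] : (0, x) = (0, y) :> quad_mod q by apply: i; rewrite !quad_linE e1.
  - move=> x; split=> [x0|[u <-]].
      have /ip[[u v] [_ <-]] : quad_lin ab' (0, x) = 0 by rewrite quad_linE x0 linear0.
      by exists v.
    have /ip : exists w, quad_lin ab w = (0, b u) by exists (0, u); rewrite quad_linE linear0.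
    by case.
  - by move=> x; have [[u v] [_ <-]] := sp (0, x); exists v.
split=> [[x y] [x' y']|[x y]|[x y]].
- by rewrite !quad_linE => -[/i1 -> /i2 ->].
- rewrite quad_linE; split=> [[/ip1[u <-] /ip2[v <-]]|[[u v]]]; first by exists (u, v).
  rewrite quad_linE => -[<- <-]; congr (_, _); [apply/ip1; by exists u|apply/ip2; by exists v].
- by have [u <-] := sp1 x; have [v <-] := sp2 y; exists (u, v).
Qed.

Lemma quad_short_exact_inv q1 q2 q3 (F : {linear quad_mod q1 -> quad_mod q2})
    (G : {linear quad_mod q2 -> quad_mod q3}) :
  short_exact F G -> exists a b a' b',
  [/\ @compat q1 q2 a b /\ @compat q2 q3 a' b', short_exact a a', short_exact b b',
   forall x y, F (x, y) = (a x, b y) & forall x y, G (x, y) = (a' x, b' y)].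
Proof.
move=> [iF FG sG]; have [a [b [ab abE]]] := quad_lin_inv F.
have [a' [b' [ab' abE']]] := quad_lin_inv G; exists a, b, a', b'.
have /quad_short_exact[ea eb] : short_exact (quad_lin ab) (quad_lin ab'); last by split.
split=> [[x y] [x' y']|[x y]|w].
- by rewrite !quad_linE -!abE => /iF.
- rewrite quad_linE -abE' FG; split=> -[[u v] uv]; exists (u, v); move: uv.
    by rewrite quad_linE abE.
  by rewrite quad_linE abE.
- by have [[x y] xyE] := sG w; exists (x, y); rewrite quad_linE -abE'.
Qed.

Section QuadExt.
Variables q1 q2 : quad c.

Lemma quad_ext_section : ext_split (quad_mod q1) (quad_mod q2) ->
  forall e a b a' b', @compat q2 e a b -> @compat e q1 a' b' ->
  short_exact a a' -> short_exact b b' ->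
  exists s t, [/\ @compat q1 e s t, forall x, a' (s x) = x & forall y, b' (t y) = y].
Proof.
move=> sp e a b a' b' ab ab' ea eb.
have ex : short_exact (quad_lin ab) (quad_lin ab') by apply/quad_short_exact.
have [F FE] := sp _ _ _ ex; have [s [t [st stE]]] := quad_lin_inv F.
exists s, t; split=> // [x|y].
  by have := FE (x, 0); rewrite stE quad_linE => -[].
by have := FE (0, y); rewrite stE quad_linE => -[].
Qed.

(** The middle term of an extension is an arbitrary module; replacing it by an isomorphic quadruple
    splits the extension into a sequence of A-modules and one of B-modules. *)
Lemma quad_extend_iso (E : lmodType L) (i : {linear quad_mod q2 -> E})
    (p : {linear E -> quad_mod q1}) : short_exact i p ->
  exists e a b a' b' (F : {linear quad_mod e -> E}) (G : {linear E -> quad_mod e}),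
  [/\ @compat q2 e a b /\ @compat e q1 a' b', short_exact a a', short_exact b b',
   forall x y, F (a x, b y) = i (x, y) & forall x y, p (F (x, y)) = (a' x, b' y)]
   /\ (forall w, G (F w) = w).
Proof.
move=> ex; have [e [G bG]] := quad_exists E.
have [F [GF FG]] := bij_lin_inv bG.
have [a [b [a' [b' [ab ea eb abE abE']]]]] := quad_short_exact_inv (short_exact_mid GF FG ex).
exists e, a, b, a', b', F, G; split=> //.
by split=> // x y; rewrite -?abE -?abE' comp_linE ?GF.
Qed.

Lemma quad_ext_of_section :
  (forall e a b a' b', @compat q2 e a b -> @compat e q1 a' b' ->
   short_exact a a' -> short_exact b b' ->
   exists s t, [/\ @compat q1 e s t, forall x, a' (s x) = x & forall y, b' (t y) = y]) ->
  ext_split (quad_mod q1) (quad_mod q2).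
Proof.
move=> sp E i p ex.
have [e [a [b [a' [b' [F [G [[[ab ab'] ea eb Fi pF] GF]]]]]]]] := quad_extend_iso ex.
have [s [t [st as_ bt]]] := sp _ _ _ _ _ ab ab' ea eb.
by exists (comp_lin F (quad_lin st)) => -[x y]; rewrite comp_linE quad_linE pF as_ bt.
Qed.

Lemma quad_ext_of_retraction :
  (forall e a b a' b', @compat q2 e a b -> @compat e q1 a' b' ->
   short_exact a a' -> short_exact b b' ->
   exists s t, [/\ @compat e q2 s t, forall x, s (a x) = x & forall y, t (b y) = y]) ->
  ext_split (quad_mod q1) (quad_mod q2).
Proof.
move=> sp E i p ex; apply: (retraction_section ex).
have [e [a [b [a' [b' [F [G [[[ab ab'] ea eb Fi pF] GF]]]]]]]] := quad_extend_iso ex.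
have [s [t [st as_ bt]]] := sp _ _ _ _ _ ab ab' ea eb.
exists (comp_lin (quad_lin st) G) => -[x y].
by rewrite comp_linE -Fi GF quad_linE as_ bt.
Qed.

End QuadExt.

End QuadMaps.

(** * Constructions of quadruples *)

Section Constructions.
Variables (A B : pzRingType) (M : bimodType B A) (N : bimodType A B).
Variable c : morita_context M N.
Local Notation L := (morita_ring c).
Implicit Types q e : quad c.

Section PhiHom.
Variable Y : lmodType B.
Let phi_hom_fun_linear (n : N) (y : Y) :
  linear (fun m : M => (mphi c (tens m n) : B) *: y).
Proof.
move=> r m m'; rewrite tensDl linearD scalerDl -scale_tens linearZ_LR.
by rewrite -scalerA.
Qed.
Let phi_hom_fun (n : N) (y : Y) : homMod M Y := mklin (phi_hom_fun_linear n y).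

Lemma phi_hom_exists : exists h : {linear tensor N Y -> homMod M Y},
  forall m n y, hom_fun (h (tens n y)) m = (mphi c (tens m n) : B) *: y.
Proof.
have bal : balanced phi_hom_fun.
  split=> [n n' y|n y y'|n r y]; apply: hom_ext => m.
  - by rewrite /hom_fun /= tensDr linearD scalerDl.
  - by rewrite /hom_fun /= scalerDr.
  - by rewrite /hom_fun /= -rscale_tens mphi_rscale -scalerA.
have [r n y|h hE] := tensor_univ bal; last by exists h => m n y; rewrite hE.
by apply: hom_ext => m; rewrite /hom_fun /= /hom_fun /= tensS.
Qed.

Definition phi_hom : {linear tensor N Y -> homMod M Y} := projT1 (cid phi_hom_exists).
Lemma phi_homE m n y : hom_fun (phi_hom (tens n y)) m = (mphi c (tens m n) : B) *: y.
Proof. by rewrite /phi_hom; case: cid. Qed.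
End PhiHom.

Lemma phi_hom_natural (Y Y' : lmodType B) (b : {linear Y -> Y'}) t :
  hom_map M b (phi_hom Y t) = phi_hom Y' (tensor_map N b t).
Proof.
apply: (tensor_ext (f := comp_lin (hom_map M b) (phi_hom Y))
  (g := comp_lin (phi_hom Y') (tensor_map N b))) t => n y.
apply: hom_ext => m; rewrite !comp_linE hom_mapE /= tensor_map_tens !phi_homE.
exact: linearZ_LR.
Qed.

(** This is [qfg] transposed; it shows that the composite of g and the adjoint of f depends on Y
    alone. *)
Lemma qh_qg q t : qh q (qg q t) = phi_hom (qY q) t.
Proof.
apply: (tensor_ext (f := comp_lin (qh q) (qg q))) t => n y.
by apply: hom_ext => m; rewrite phi_homE -qfg.
Qed.

Section Uncurry.
Variables (X : lmodType A) (Y : lmodType B) (h : {linear X -> homMod M Y}).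
Lemma uncurry_exists : exists f : {linear tensor M X -> Y},
  forall m x, f (tens m x) = hom_fun (h x) m.
Proof.
apply: tensor_univ => [|r m x]; last by rewrite /hom_fun linearZ_LR.
split=> [m m' x|m x x'|m s x]; first by rewrite /hom_fun linearD.
  by rewrite linearD.
by rewrite linearZ_LR.
Qed.
Definition uncurry := projT1 (cid uncurry_exists).
Lemma uncurryE m x : uncurry (tens m x) = hom_fun (h x) m.
Proof. by rewrite /uncurry; case: cid. Qed.
End Uncurry.

Hypothesis hNM : forall t : tensor N M, t = 0.

(** The value factors through n ⊗ m = 0. It is applied to g (n ⊗ f (m ⊗ x)) with x fixed, which must
    equal psi (n ⊗ m) x = 0. *)
Lemma balanced_NM (G : zmodType) (b : N -> M -> G) n m : balanced b -> b n m = 0.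
Proof.
move=> bal; rewrite -(tensor_lift_tens bal) (hNM (tens n m)).
by apply: (addrI (tensor_lift b 0)); rewrite -tensor_liftD // !addr0.
Qed.

(* The quadruple given by h : X -> Hom(M, Y) and g : N ⊗ Y -> X; the other
   compatibility condition is void because N ⊗ M = 0. *)
Section MkQuad.
Variables (X : lmodType A) (Y : lmodType B).
Variables (h : {linear X -> homMod M Y}) (g : {linear tensor N Y -> X}).
Hypothesis hg : forall t, h (g t) = phi_hom Y t.

Let mkquad_gf (n : N) (m : M) (x : X) :
  g (tens n (uncurry h (tens m x))) = (mpsi c (tens n m) : A) *: x.
Proof.
rewrite (hNM (tens n m)) linear0 scale0r.
apply: (balanced_NM (b := fun n m => g (tens n (uncurry h (tens m x))))).
split=> [n1 n2 m1|n1 m1 m2|n1 r m1].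
- by rewrite tensDl linearD.
- by rewrite tensDl linearD tensDr linearD.
- by rewrite tensS -linearZ_LR scale_tens.
Qed.
Let mkquad_fg (m : M) (n : N) (y : Y) :
  uncurry h (tens m (g (tens n y))) = (mphi c (tens m n) : B) *: y.
Proof. by rewrite uncurryE hg phi_homE. Qed.

Definition mkquad : quad c := Quad mkquad_gf mkquad_fg.

Lemma qh_mkquad (x : X) : qh mkquad x = h x.
Proof. by apply: hom_ext => m; exact: uncurryE. Qed.

End MkQuad.

Definition zero_mod (R : pzRingType) : lmodType R := ker (id_lin R^o).
Lemma zero_mod_eq (R : pzRingType) (x y : zero_mod R) : x = y.
Proof. by apply: ker_lin_inj; exact: etrans (ker_linK x) (esym (ker_linK y)). Qed.

Lemma hom_zero_eq (h k : homMod M (zero_mod B)) : h = k.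
Proof. by apply: hom_ext => m; exact: zero_mod_eq. Qed.

Section inflA.
Variable C : lmodType A.
Let inflA_law t : zero_lin C (homMod M (zero_mod B)) (zero_lin (tensor N (zero_mod B)) C t) =
  phi_hom _ t.
Proof. exact: hom_zero_eq. Qed.
(* (C, 0) *)
Definition inflA : quad c := mkquad inflA_law.
End inflA.

(* Left adjoint of (X, Y) |-> Y: the module (N ⊗ Y, Y). *)
Definition indB (Y : lmodType B) : quad c :=
  mkquad (h := phi_hom Y) (g := id_lin _) (fun t => erefl).

(* Right adjoint of (X, Y) |-> Y: the module (Hom(M, Y), Y). *)
Definition coindB (Y : lmodType B) : quad c :=
  mkquad (h := id_lin _) (g := phi_hom Y) (fun t => erefl).

Lemma qh_coindB (Y : lmodType B) (h : homMod M Y) : qh (coindB Y) h = h.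
Proof. exact: qh_mkquad. Qed.

Lemma id_short_exact (Y : lmodType B) : short_exact (id_lin Y) (zero_lin Y (zero_mod B)).
Proof.
split=> // [y|y]; last by exists 0; exact: zero_mod_eq.
by split=> _; [exists y|exact: zero_mod_eq].
Qed.

Lemma zero_short_exact (Y : lmodType B) : short_exact (zero_lin (zero_mod B) Y) (id_lin Y).
Proof.
split=> // [y z _|y|y]; [exact: zero_mod_eq| |by exists y].
by split=> [y0|[x <-]] //; exists 0; exact: esym y0.
Qed.

Lemma hom_map_id (Y : lmodType B) (f : {linear Y -> Y}) (h : homMod M Y) :
  f =1 id -> hom_map M f h = h.
Proof. by move=> fE; apply: hom_ext => m; rewrite hom_mapE fE. Qed.

Lemma hom_map_comp (Y Y' Y'' : lmodType B) (f : {linear Y' -> Y''}) (g : {linear Y -> Y'})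
  (h : homMod M Y) : hom_map M f (hom_map M g h) = hom_map M (comp_lin f g) h.
Proof. exact: hom_ext. Qed.

Lemma hom_map0 (Y Y' : lmodType B) (f : {linear Y -> Y'}) (h : homMod M Y) :
  (forall y, f y = 0) -> hom_map M f h = 0.
Proof. by move=> fE; apply: hom_ext => m; rewrite hom_mapE fE. Qed.

(* The quadruple (X ⊔_{N ⊗ Y} N ⊗ F, F). *)
Lemma quad_pushout q (F C : lmodType B) (i : {linear qY q -> F}) (p : {linear F -> C}) :
  short_exact i p -> injective (tensor_map N i) ->
  exists (E : lmodType A) (h : {linear E -> homMod M F}) (g : {linear tensor N F -> E})
    (hg : forall t, h (g t) = phi_hom F t) (e := mkquad hg)
    (j : {linear qX q -> E}) (r : {linear E -> tensor N C}),
  [/\ @compat _ _ _ _ c q e j i, @compat _ _ _ _ c e (indB C) r p & short_exact j r].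
Proof.
move=> ex iN; have [ii ip sp] := ex.
have exN : short_exact (tensor_map N i) (tensor_map N p).
  by split=> //; [exact: tensor_right_exact|exact: tensor_map_surj].
have [E [j [l [r [exE li rl jl jl0]]]]] := pushout_exact (qg q) exN.
have sjl : surj (copair_lin j l).
  by move=> e; have [x [v ->]] := jl e; exists (x, v).
(* On X the new h is the old one followed by Hom(M, i), on N ⊗ F it is [phi_hom]; they agree on N ⊗
   Y by [qh_qg] and naturality. *)
have [[x t]|h hE] := factor_surj
    (h := copair_lin (comp_lin (hom_map M i) (qh q)) (phi_hom F)) sjl.
  change (j x + l t = 0 -> hom_map M i (qh q x) + phi_hom F t = 0).
  move=> /jl0[u -> ->]; rewrite 2!linearN -[phi_hom F _]phi_hom_natural.
  by rewrite -qh_qg addNr.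
have hj x : h (j x) = hom_map M i (qh q x).
  by have := hE (x, 0); rewrite /= !linear0 !addr0.
have hl t : h (l t) = phi_hom F t.
  have : h (j 0 + l t) = hom_map M i (qh q 0) + phi_hom F t := hE (0, t).
  by rewrite !linear0 !add0r.
exists E, h, l, hl, j, r; split=> //; [split=> [x|t]|split=> [e|t]].
- by rewrite qh_mkquad hj.
- by rewrite /= li.
- rewrite !qh_mkquad; have [x [t ->]] := jl e.
  rewrite !linearD hj hl (short_exact_comp0 _ exE) linear0 add0r rl.
  rewrite hom_map_comp hom_map0 ?add0r; first exact: phi_hom_natural.
  by move=> y; exact: short_exact_comp0 ex.
- by rewrite /= rl.
Qed.

(** Enlarging X while Y stays fixed only requires an extension of h to E; g is composed with the
    inclusion. *)
Lemma quad_extend_X q (E C : lmodType A) (i : {linear qX q -> E}) (p : {linear E -> C})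
    (h : {linear E -> homMod M (qY q)}) :
  short_exact i p -> (forall x, h (i x) = qh q x) ->
  exists (hg : forall t, h (comp_lin i (qg q) t) = phi_hom _ t) (e := mkquad hg),
  @compat _ _ _ _ c q e i (id_lin _) /\ @compat _ _ _ _ c e (inflA C) p (zero_lin _ _).
Proof.
move=> ex hi; have hg t : h (comp_lin i (qg q) t) = phi_hom _ t.
  by rewrite comp_linE hi qh_qg.
exists hg; split; [split=> [x|t]|split=> [x|t]].
- by rewrite qh_mkquad hi hom_map_id.
- by rewrite /= (tensor_map_id (f := id_lin _)).
- exact: hom_zero_eq.
- exact: short_exact_comp0 ex.
Qed.

(** Dually, a lift of g to E suffices, and h is composed with the projection. *)
Lemma quad_coextend_X q (X' E : lmodType A) (i : {linear X' -> E}) (p : {linear E -> qX q})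
    (g : {linear tensor N (qY q) -> E}) :
  short_exact i p -> (forall t, p (g t) = qg q t) ->
  exists (hg : forall t, comp_lin (qh q) p (g t) = phi_hom _ t) (e := mkquad hg),
  @compat _ _ _ _ c (inflA X') e i (zero_lin _ _) /\ @compat _ _ _ _ c e q p (id_lin _).
Proof.
move=> ex pg; have hg t : comp_lin (qh q) p (g t) = phi_hom _ t.
  by rewrite comp_linE pg qh_qg.
exists hg; split; [split=> [x|t]|split=> [x|t]].
- by rewrite qh_mkquad comp_linE (short_exact_comp0 _ ex) linear0 hom_map0.
- change (i 0 = g (tensor_map N (zero_lin (zero_mod B) (qY q)) t)).
  by rewrite [tensor_map _ _ _]tensor_map0 // !linear0.
- by rewrite qh_mkquad hom_map_id.
- by rewrite [qg _ t]/= pg (tensor_map_id (f := id_lin _)).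
Qed.

Lemma hom_map_inj (Y Y' : lmodType B) (i : {linear Y -> Y'}) :
  injective i -> injective (hom_map M i).
Proof.
move=> ii h k e; apply: hom_ext => m; apply: ii.
exact: (congr1 (fun h => hom_fun h m) e).
Qed.

(* The quadruple (X x_{Hom(M, Y)} Hom(M, F), F). *)
Lemma quad_pullback q (K F : lmodType B) (i : {linear K -> F}) (p : {linear F -> qY q}) :
  short_exact i p -> surj (hom_map M p) ->
  exists (E : lmodType A) (h : {linear E -> homMod M F}) (g : {linear tensor N F -> E})
    (hg : forall t, h (g t) = phi_hom F t) (e := mkquad hg)
    (j : {linear homMod M K -> E}) (r : {linear E -> qX q}),
  [/\ @compat _ _ _ _ c (coindB K) e j i, @compat _ _ _ _ c e q r p & short_exact j r].
Proof.
move=> ex sM; have [ii ip sp] := ex.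
have exM : short_exact (hom_map M i) (hom_map M p).
  split=> //; first exact: hom_map_inj.
  move=> h; split=> [h0|[k <-]]; last first.
    by rewrite hom_map_comp hom_map0 // => y; exact: short_exact_comp0 ex.
  have [m|k kE] := factor_inj (h := (h : {linear M -> F})) ii.
    by apply/ip; exact: (congr1 (fun h => hom_fun h m) h0).
  by exists (k : homMod M K); apply: hom_ext.
have [E [j [l [r [exE lj hr lr]]]]] := pullback_exact (qh q) exM.
have [ij jr sr] := exE.
have ilr : injective (pair_lin l r).
  apply: ker_inj => e [le re]; have /jr[k kE] := re; rewrite -kE.
  suff -> : k = 0 by exact: linear0.
  by apply: (inj_ker (hom_map_inj ii)); rewrite -lj kE le.
(* The map g into the pullback has components [phi_hom] and the old g after N ⊗ p. *)
have [t|g gE] := factor_inj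
    (h := pair_lin (phi_hom F) (comp_lin (qg q) (tensor_map N p))) ilr.
  have [|e [le re]] := lr (qg q (tensor_map N p t)) (phi_hom F t).
    by rewrite [qh q _]qh_qg phi_hom_natural.
  by exists e; congr (_, _).
have lg t : l (g t) = phi_hom F t by case: (gE t).
have rg t : r (g t) = qg q (tensor_map N p t) by case: (gE t).
exists E, l, g, lg, j, r; split=> //; [split=> [x|t]|split=> [e|t]].
- by rewrite !qh_mkquad lj.
- apply: ilr; congr (_, _); rewrite /= ?lj ?lg ?rg; first exact: phi_hom_natural.
  rewrite [LHS](short_exact_comp0 _ exE) tensor_map_comp tensor_map0 ?linear0 //.
  by move=> y; exact: short_exact_comp0 ex.
- by rewrite qh_mkquad hr.
- exact: rg.
Qed.

End Constructions.

Lemma ext_split_zero_l (R : pzRingType) (C : lmodType R) : ext_split (zero_mod R) C.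
Proof.
apply: projective_ext => P Q p h sp; exists (zero_lin _ _) => x.
by rewrite linear0 (zero_mod_eq x 0) linear0.
Qed.

Lemma ext_split_zero_r (R : pzRingType) (C : lmodType R) : ext_split C (zero_mod R).
Proof.
move=> E i p ex; apply: (retraction_section ex); exists (zero_lin _ _) => x.
exact: zero_mod_eq.
Qed.

(** * Orthogonality *)

Section Orthogonality.
Variables (A B : pzRingType) (M : bimodType B A) (N : bimodType A B).
Variable c : morita_context M N.
Hypothesis hNM : forall t : tensor N M, t = 0.
Implicit Types q e : quad c.
Local Notation inflA := (inflA c hNM).
Local Notation indB := (indB c hNM).
Local Notation coindB := (coindB c hNM).
Local Notation Z q := (quad_mod q : lmodType (morita_ring c)).

Lemma short_exact_right0 (Y E : lmodType B) (i : {linear Y -> E})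
    (p : {linear E -> zero_mod B}) : short_exact i p ->
  exists j : {linear E -> Y}, cancel i j /\ cancel j i.
Proof.
move=> [ii ip _]; apply/bij_lin_inv/bij_of => // e; apply/ip; exact: zero_mod_eq.
Qed.

Lemma short_exact_left0 (Y E : lmodType B) (i : {linear zero_mod B -> E})
    (p : {linear E -> Y}) : short_exact i p ->
  exists j : {linear Y -> E}, cancel p j /\ cancel j p.
Proof.
move=> [_ ip sp]; apply/bij_lin_inv/bij_of => //; apply: ker_inj => e /ip[x <-].
by rewrite (zero_mod_eq x 0) linear0.
Qed.

(** A section from (C, 0) must land in the kernel of h on the middle term. As the lower components
    of q and e are isomorphic and h is onto, that kernel is an extension of C by Ker h, which
    splits. *)
Lemma inflA_ext q (C : lmodType A) :
  surj (qh q) -> ext_split C (ker (qh q)) -> ext_split (Z (inflA C)) (Z q).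
Proof.
move=> sh sC; apply: quad_ext_of_section => e a b a' b' [ab1 ab2] [ab1' ab2'] ea eb.
have [j [bj jb]] := short_exact_right0 eb; have [ia aa' sa'] := ea.
pose ke := ker_lin (qh e); pose p := comp_lin a' ke.
have sp : surj p.
  move=> x; have [y yE] := sa' x; have [z zE] := sh (hom_map M j (qh e y)).
  have /ker_linP[k kE] : qh e (y - a z) = 0.
    rewrite linearB -ab1 zE hom_map_comp hom_map_id ?subrr //.
  by exists k; rewrite /p comp_linE [ke k]kE linearB yE (short_exact_comp0 _ ea) subr0.
have [u|i iE] := factor_inj (h := comp_lin a (ker_lin (qh q))) (@ker_lin_inj _ _ _ (qh e)).
  by apply/ker_linP; rewrite comp_linE -ab1 ker_linK linear0.
have ex : short_exact i p.
  split=> // [x y xy|k].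
    by apply: ker_lin_inj; apply: ia; rewrite -!comp_linE -!iE xy.
  split=> [/aa'[x xE]|[x <-]]; last first.
    by rewrite /p comp_linE [ke _]iE comp_linE (short_exact_comp0 _ ea).
  have /ker_linP[u uE] : qh q x = 0.
    apply: (hom_map_inj (M := M) (can_inj bj)).
    by rewrite ab1 xE [qh e _]ker_linK linear0.
  by exists u; apply: ker_lin_inj; rewrite iE comp_linE uE xE.
have [s sE] := sC _ _ _ ex.
exists (comp_lin ke s), (zero_lin _ _); split=> [|x|y]; last exact: zero_mod_eq.
  split=> [x|t]; first by rewrite hom_map0 // comp_linE [RHS]ker_linK.
  by rewrite tensor_map0 // linear0 [qg _ _]/= linear0.
by rewrite comp_linE -comp_linE sE.
Qed.

Lemma pair_short_exact (R : pzRingType) (X P : lmodType R) :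
  short_exact (pair_lin (id_lin X) (zero_lin X P)) (snd_lin X P).
Proof.
split=> [x y [] //|[x u]|u]; last by exists (0, u).
by split=> [/= ->|[y [_ <-]]] //; exists x.
Qed.

Lemma quad_add q (P : lmodType A) (p : {linear P -> homMod M (qY q)})
    (i := pair_lin (id_lin (qX q)) (zero_lin (qX q) P)) :
  exists (hg : forall t, copair_lin (qh q) p (comp_lin i (qg q) t) = phi_hom c _ t)
    (e := mkquad hNM hg),
  @compat _ _ _ _ c q e i (id_lin _) /\
  @compat _ _ _ _ c e (inflA P) (snd_lin _ _) (zero_lin _ _).
Proof.
by apply: quad_extend_X (pair_short_exact _ _) _ => x; rewrite /= linear0 addr0.
Qed.

(** A section of X ⊕ P over P sends u to some (x, u) in the kernel of the combined map, so that p u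
    = - h x; thus h attains every value of p up to sign. *)
Lemma inflA_ext_surj q (P : lmodType A) (p : {linear P -> homMod M (qY q)}) :
  surj p -> ext_split (Z (inflA P)) (Z q) -> surj (qh q).
Proof.
move=> sp sP; have [hg [ab ab']] := quad_add p.
have ex := pair_short_exact (qX q) P.
have [s [t [[st _] rs _]]] := quad_ext_section sP ab ab' ex (id_short_exact _).
move=> k; have [u uE] := sp (- k); exists (s u).1.
have := st u; rewrite hom_map0 ?qh_mkquad; last by move=> y; rewrite (zero_mod_eq y 0) linear0.
have ru : (s u).2 = u := rs u.
by move=> /esym/eqP; rewrite /= ru uE subr_eq0 => /eqP.
Qed.

(** Pushing X out along Ker h -> F, and letting the new h vanish on F, makes F the new kernel
    without changing Y. *)
Lemma quad_pushout_ker q (F C : lmodType A) (i : {linear ker (qh q) -> F})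
    (p : {linear F -> C}) : short_exact i p ->
  exists (E : lmodType A) (h : {linear E -> homMod M (qY q)})
    (g : {linear tensor N (qY q) -> E}) (hg : forall t, h (g t) = phi_hom c _ t)
    (e := mkquad hNM hg) (j : {linear qX q -> E}) (r : {linear E -> C}) (l : {linear F -> E}),
  [/\ @compat _ _ _ _ c q e j (id_lin _),
      @compat _ _ _ _ c e (inflA C) r (zero_lin _ _) & short_exact j r] /\
  [/\ forall y, h y = 0 <-> (exists v, l v = y),
      injective l, forall x, h (j x) = qh q x & forall v, r (l v) = p v].
Proof.
move=> ex; have [ii ip sp] := ex.
have [E [j [l [r [exE li rl jl jl0]]]]] := pushout_exact (ker_lin (qh q)) ex.
have sjl : surj (copair_lin j l).
  by move=> e; have [x [v ->]] := jl e; exists (x, v).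
have [[x t]|h hE] := factor_surj (h := comp_lin (qh q) (fst_lin (qX q) F)) sjl.
  change (j x + l t = 0 -> qh q x = 0).
  by move=> /jl0[u _ ->]; rewrite linearN ker_linK oppr0.
have hjl x v : h (j x + l v) = qh q x := hE (x, v).
have hj x : h (j x) = qh q x by rewrite -(hjl x 0) linear0 addr0.
have hl v : h (l v) = 0 by have := hjl 0 v; rewrite !linear0 add0r.
have [hg [ab ab']] := quad_extend_X hNM exE hj.
have il : injective l.
  apply: ker_inj => v lv; have /jl0[u -> /eqP] : j 0 + l v = 0 by rewrite linear0 add0r.
  by rewrite eq_sym oppr_eq0 => /eqP/(inj_ker (@ker_lin_inj _ _ _ (qh q))) ->; rewrite linear0.
have hy y : h y = 0 <-> exists v, l v = y.
  split=> [|[v <-] //]; have [x [v ->]] := jl y; rewrite hjl => /ker_linP[k <-].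
  by exists (i k + v); rewrite linearD li.
exists E, h, (comp_lin j (qg q)), hg, j, r, l; by split; split.
Qed.

Lemma inflA_ext_ker q (C : lmodType A) :
  ext_split (Z (inflA C)) (Z q) -> ext_split C (ker (qh q)).
Proof.
move=> sC F i p ex.
have [E [h [g [hg [j [r [l [[ab ab' exE] [hl il _ rl]]]]]]]]] := quad_pushout_ker ex.
have [s [t [[st _] rs _]]] := quad_ext_section sC ab ab' exE (id_short_exact _).
have [u|s' s'E] := factor_inj (h := s) il.
  apply/hl; have := st u; rewrite hom_map0 ?qh_mkquad // => y.
  by rewrite (zero_mod_eq y 0) linear0.
by exists s' => u; rewrite -rl s'E rs.
Qed.

(** A section t of the lower row determines the upper one: apply N ⊗ t and then g. *)
Lemma indB_ext q (V : lmodType B) : ext_split V (qY q) -> ext_split (Z (indB V)) (Z q).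
Proof.
move=> sV; apply: quad_ext_of_section => e a b a' b' [ab1 ab2] [ab1' ab2'] ea eb.
have [t tE] := sV _ _ _ eb.
exists (comp_lin (qg e) (tensor_map N t)), t; split=> //.
  split=> [x|x] //; rewrite comp_linE !qh_qg.
  exact: phi_hom_natural.
move=> x; rewrite comp_linE ab2' tensor_map_comp; exact: tensor_map_id.
Qed.

(** The vanishing of Tor lets [quad_pushout] realise the given extension as a lower row, so a
    section of Λ-modules contains the one sought. *)
Lemma indB_ext_Y q (V : lmodType B) : Tor1_eq0 N V ->
  ext_split (Z (indB V)) (Z q) -> ext_split V (qY q).
Proof.
move=> tor sV F i p ex.
have [E [h [g [hg [j [r [ab ab' exE]]]]]]] := quad_pushout hNM ex (Tor1_eq0_inj tor ex).
have [s [t [_ _ tE]]] := quad_ext_section sV ab ab' exE ex.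
by exists t.
Qed.

(** A retraction onto (X, 0) must kill the image of g on the middle term. Injectivity of g makes the
    cokernel there an extension of Coker g by X, which splits. *)
Lemma ext_inflA q (X : lmodType A) :
  injective (qg q) -> ext_split (coker (qg q)) X -> ext_split (Z q) (Z (inflA X)).
Proof.
move=> ig sX; apply: quad_ext_of_retraction => e a b a' b' [ab1 ab2] [ab1' ab2'] ea eb.
have [j [bj jb]] := short_exact_left0 eb; have [ia aa' sa'] := ea.
have Nj t : tensor_map N j (tensor_map N b' t) = t.
  by rewrite tensor_map_comp; exact: tensor_map_id.
have jN t : tensor_map N b' (tensor_map N j t) = t.
  by rewrite tensor_map_comp; exact: tensor_map_id.
pose pe := coker_lin (qg e); pose i := comp_lin pe a.
have [x|p pE] := factor_surj (h := comp_lin (coker_lin (qg q)) a') (@coker_lin_surj _ _ _ (qg e)).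
  by move=> /coker_linP[t <-]; rewrite comp_linE ab2'; apply/coker_linP; exists (tensor_map N b' t).
have ex : short_exact i p.
  split=> [|y|y].
  - apply: ker_inj => x /coker_linP[t tE]; apply: (inj_ker ia); rewrite -tE -[t]Nj.
    suff -> : tensor_map N b' t = 0 by rewrite !linear0.
    by apply: (inj_ker ig); rewrite -ab2' tE (short_exact_comp0 _ ea).
  - split=> [|[x <-]]; last by rewrite /i comp_linE pE comp_linE (short_exact_comp0 _ ea) linear0.
    have [x <-] := coker_lin_surj y; rewrite pE comp_linE => /coker_linP[t tE].
    have /aa'[z zE] : a' (x - qg e (tensor_map N j t)) = 0.
      by rewrite linearB ab2' jN tE subrr.
    exists z; rewrite /i comp_linE zE linearB.
    have /coker_linP -> : exists t', qg e t' = qg e (tensor_map N j t) by exists (tensor_map N j t).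
    exact: subr0.
  - have [x <-] := coker_lin_surj y; have [z <-] := sa' x.
    by exists (pe z); rewrite pE.
have [r rE] := section_retraction ex (sX _ _ _ ex).
exists (comp_lin r pe), (zero_lin _ _); split=> [|x|y]; last exact: zero_mod_eq.
  split=> [x|t]; first exact: hom_zero_eq.
  rewrite comp_linE; have /coker_linP -> : exists t', qg e t' = qg e t by exists t.
  by rewrite tensor_map0 // !linear0.
exact: rE.
Qed.

(** If g t = 0 with t nonzero, take h into the character module with h t nonzero and use (h, g) as
    structure map on the sum of the character module and X. A section of this extension sends g t =
    0 to (h t, 0), a contradiction. *)
Lemma ext_inflA_inj q : ext_split (Z q) (Z (inflA (char_mod A))) -> injective (qg q).
Proof.
move=> sI; apply: ker_inj => t gt0; apply: contrapT => /(@char_mod_separates A)[h]; apply.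
pose i := pair_lin (id_lin (char_mod A)) (zero_lin (char_mod A) (qX q)).
pose r := snd_lin (char_mod A) (qX q); pose g := pair_lin h (qg q).
have ex : short_exact i r := pair_short_exact _ _.
have [hg [ab ab']] := quad_coextend_X hNM ex (fun t => erefl : r (g t) = qg q t).
have [s [t' [[_ st] _ tE]]] := quad_ext_section sI ab ab' ex (zero_short_exact _).
have := st t; rewrite gt0 linear0 (tensor_map_id tE).
by move=> /(congr1 fst)/esym.
Qed.

(** Pull the extension back to X and lift g with zero component in F. A section followed by the map
    to F then kills the image of g and descends to Coker g. *)
Lemma ext_inflA_coker q (X : lmodType A) :
  ext_split (Z q) (Z (inflA X)) -> ext_split (coker (qg q)) X.
Proof.
move=> sX F i p ex; have [ii ip sp] := ex.
have [E [j [l [r [exE lj pr lr]]]]] := pullback_exact (coker_lin (qg q)) ex.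
have [ij jr sr] := exE.
have ilr : injective (pair_lin l r).
  apply: ker_inj => e [le re]; have /jr[k kE] := re; rewrite -kE.
  by rewrite (inj_ker ii (u := k)) ?linear0 // -lj kE.
have [t|g gE] := factor_inj (h := pair_lin (zero_lin _ F) (qg q)) ilr.
  have [|e [le re]] := lr (qg q t) 0; last by exists e; congr (_, _).
  by rewrite linear0; apply/coker_linP; exists t.
have rg t : r (g t) = qg q t by case: (gE t).
have lg t : l (g t) = 0 by case: (gE t).
have [hg [ab ab']] := quad_coextend_X hNM exE rg.
have [s [t' [[_ st] rs tE]]] := quad_ext_section sX ab ab' exE (zero_short_exact _).
have [x|s' s'E] := factor_surj (h := comp_lin l s) (@coker_lin_surj _ _ _ (qg q)).
  by move=> /coker_linP[t <-]; rewrite comp_linE st; exact: lg.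
exists s' => x; have [y <-] := coker_lin_surj x.
by rewrite s'E comp_linE -pr rs.
Qed.

Lemma ext_coindB q (Y : lmodType B) : ext_split (qY q) Y -> ext_split (Z q) (Z (coindB Y)).
Proof.
move=> sY; apply: quad_ext_of_retraction => e a b a' b' [ab1 ab2] [ab1' ab2'] ea eb.
have [t tE] := section_retraction eb (sY _ _ _ eb).
exists (comp_lin (hom_map M t) (qh e)), t; split=> //.
  split=> [x|x]; first by rewrite qh_coindB.
  by rewrite comp_linE qh_qg; exact: phi_hom_natural.
move=> x; rewrite comp_linE -ab1 qh_coindB hom_map_comp; exact: hom_map_id.
Qed.

(** The vanishing of Ext(M, Y) lifts maps from M along p, which is the surjectivity that
    [quad_pullback] requires. *)
Lemma ext_coindB_Y q (Y : lmodType B) : ext_split M Y ->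
  ext_split (Z q) (Z (coindB Y)) -> ext_split (qY q) Y.
Proof.
move=> sM sY F i p ex.
have [h|E [h [g [hg [j [r [ab ab' exE]]]]]]] := quad_pullback hNM ex.
  have [k kE] := ext_lift (h : {linear M -> qY q}) ex sM.
  by exists (k : homMod M F); apply: hom_ext.
have [s [t [_ _ tE]]] := quad_ext_section sY ab ab' exE ex.
by exists t.
Qed.

End Orthogonality.

(** * The cotorsion pairs *)

Section Assembly.
Variables (A B : pzRingType) (M : bimodType B A) (N : bimodType A B).
Variable c : morita_context M N.
Hypothesis hNM : forall t : tensor N M, t = 0.
Variables (U X : mod_class A) (V Y : mod_class B).
Hypotheses (hUX : cotorsion_pair U X) (hVY : cotorsion_pair V Y).
Implicit Types q e : quad c.
Local Notation L := (morita_ring c).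
Local Notation inflA := (inflA c hNM).
Local Notation indB := (indB c hNM).
Local Notation coindB := (coindB c hNM).
Local Notation Z q := (quad_mod q : lmodType L).
Local Notation MUV := (classM c U V).
Local Notation NXY := (classN c X Y).
Let TorNV := forall W : lmodType B, V W -> Tor1_eq0 N W.
Let ExtMY := forall W : lmodType B, Y W -> Ext1_eq0 M W.

Lemma classN_orth (W : lmodType L) : NXY W ->
  (forall C, U C -> ext_split (Z (inflA C)) W) /\
  (forall C, V C -> ext_split (Z (indB C)) W).
Proof.
move=> [q [hX hY sf] /iso_sym iW].
split=> C hC; apply: (ext_split_iso (iso_refl _) iW).
  by apply: inflA_ext => //; exact: (cotorsion_ext hUX).
by apply: indB_ext; exact: (cotorsion_ext hVY).
Qed.

Lemma classM_orth (W : lmodType L) : MUV W ->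
  (forall C, X C -> ext_split W (Z (inflA C))) /\
  (forall C, Y C -> ext_split W (Z (coindB C))).
Proof.
move=> [q [hU hV ig] /iso_sym iW].
split=> C hC; apply: (ext_split_iso iW (iso_refl _)).
  by apply: ext_inflA => //; exact: (cotorsion_ext hUX).
by apply: ext_coindB; exact: (cotorsion_ext hVY).
Qed.

Lemma classN_of_orth (W : lmodType L) : TorNV ->
  (forall C, U C -> ext_split (Z (inflA C)) W) ->
  (forall C, V C -> ext_split (Z (indB C)) W) -> NXY W.
Proof.
move=> tor eU eV; have [q iW] := quad_exists W; exists q => //; split.
- apply/(cotorsion_rightP hUX) => C hC; apply: (@inflA_ext_ker _ _ _ _ c hNM q).
  exact: ext_split_iso (iso_refl _) iW (eU _ hC).
- apply/(cotorsion_rightP hVY) => C hC; apply: (@indB_ext_Y _ _ _ _ c hNM q); first exact: tor.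
  exact: ext_split_iso (iso_refl _) iW (eV _ hC).
- apply: (@inflA_ext_surj _ _ _ _ c hNM q _ _ (@cover_map_surj _ _)).
  apply: ext_split_iso (iso_refl _) iW (eU _ _).
  exact/(cotorsion_projective hUX)/free_mod_projective.
Qed.

Lemma classM_of_orth (W : lmodType L) : ExtMY ->
  (forall C, X C -> ext_split W (Z (inflA C))) ->
  (forall C, Y C -> ext_split W (Z (coindB C))) -> MUV W.
Proof.
move=> eM eX eY; have [q iW] := quad_exists W; exists q => //; split.
- apply/(cotorsion_leftP hUX) => C hC; apply: (@ext_inflA_coker _ _ _ _ c hNM q).
  exact: ext_split_iso iW (iso_refl _) (eX _ hC).
- apply/(cotorsion_leftP hVY) => C hC.
  apply: (@ext_coindB_Y _ _ _ _ c hNM q); first exact/Ext1_eq0P/eM.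
  exact: ext_split_iso iW (iso_refl _) (eY _ hC).
(* The character module is injective, hence lies in [X]. *)
- apply: (@ext_inflA_inj _ _ _ _ c hNM q).
  apply: ext_split_iso iW (iso_refl _) (eX _ _).
  by apply/(cotorsion_rightP hUX) => C _; exact: char_mod_injective.
Qed.

Lemma classM_classN_ext (W W' : lmodType L) : MUV W -> NXY W' -> ext_split W W'.
Proof.
move=> [q [hU hV ig] /iso_sym iW] /classN_orth[oU oV].
apply: (ext_split_iso iW (iso_refl _)).
have ab : @compat _ _ _ _ c (indB (qY q)) q (qg q) (id_lin _).
  split=> [x|t]; first by rewrite !qh_qg hom_map_id.
  by rewrite (tensor_map_id (f := id_lin _)).
have ab' : @compat _ _ _ _ c q (inflA (coker (qg q))) (coker_lin (qg q)) (zero_lin _ _).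
  split=> [x|t]; first exact: hom_zero_eq.
  by apply/coker_linP; exists t.
have ex : short_exact (quad_lin ab) (quad_lin ab').
  by apply/quad_short_exact; split; [exact: short_exact_coker|exact: id_short_exact].
exact: ext_split_extl ex (oV _ hV) (oU _ hU).
Qed.

(** Since N ⊗ 0 = 0, the map g of (C, 0) is injective with cokernel C. *)
Lemma inflA_inflA_ext C C' : U C -> X C' -> ext_split (Z (inflA C)) (Z (inflA C')).
Proof.
move=> hC hC'; apply: ext_inflA.
  apply: ker_inj; elim/tensor_ind=> [//|n y t IH] _.
  by rewrite (zero_mod_eq y 0) tens0r add0r; exact: IH.
apply: (cotorsion_ext hUX) hC'; apply: cotorsion_left_iso hUX _ _ _ hC.
exists (coker_lin (qg (inflA C))); apply: bij_of; last exact: coker_lin_surj.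
by apply: ker_inj => x /coker_linP[t <-].
Qed.

Lemma classM_inflA C : ExtMY -> U C -> MUV (Z (inflA C)).
Proof.
move=> eM hC; apply: classM_of_orth => // C' hC'; first exact: inflA_inflA_ext.
exact/ext_coindB/ext_split_zero_l.
Qed.

Lemma classM_indB C : ExtMY -> V C -> MUV (Z (indB C)).
Proof.
move=> eM hC; apply: classM_of_orth => // C' hC'; apply: indB_ext.
  exact/ext_split_zero_r.
exact: (cotorsion_ext hVY).
Qed.

Lemma classN_inflA C : TorNV -> X C -> NXY (Z (inflA C)).
Proof.
move=> tor hC; apply: classN_of_orth => // C' hC'; first exact: inflA_inflA_ext.
exact/indB_ext/ext_split_zero_r.
Qed.

Lemma classN_coindB C : TorNV -> Y C -> NXY (Z (coindB C)).
Proof.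
move=> tor hC; apply: classN_of_orth => // C' hC'; apply: ext_coindB.
  exact/ext_split_zero_l.
exact: (cotorsion_ext hVY).
Qed.

(** The test modules are themselves left orthogonal to [NXY], so a module right orthogonal to that
    left class satisfies the conditions characterising [NXY]. *)
Lemma cotorsion_pair_classN : TorNV -> cotorsion_pair (lperp NXY) NXY.
Proof.
move=> tor; split=> // W; split=> [/rperpP oW|hW]; last first.
  by apply/rperpP => C /lperpP; apply.
by apply: classN_of_orth => // C hC; apply: oW; apply/lperpP => D /classN_orth[oU oV];
  [exact: oU|exact: oV].
Qed.

Lemma cotorsion_pair_classM : ExtMY -> cotorsion_pair MUV (rperp MUV).
Proof.
move=> eM; split=> // W; split=> [/lperpP oW|hW]; last first.
  by apply/lperpP => C /rperpP; apply.
by apply: classM_of_orth => // C hC; apply: oW; apply/rperpP => D /classM_orth[oX oY];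
  [exact: oX|exact: oY].
Qed.

Lemma cotorsion_pair_MN : TorNV -> ExtMY -> cotorsion_pair MUV NXY.
Proof.
move=> tor eM; split=> W; split.
- move=> /rperpP oW; apply: classN_of_orth => // C hC; apply: oW.
    exact: classM_inflA.
  exact: classM_indB.
- by move=> hW; apply/rperpP => C hC; exact: classM_classN_ext.
- move=> /lperpP oW; apply: classM_of_orth => // C hC; apply: oW.
    exact: classN_inflA.
  exact: classN_coindB.
- by move=> hW; apply/lperpP => C hC; exact: classM_classN_ext.
Qed.

Lemma classN_envelope q : TorNV -> ExtMY -> complete_pair U X -> complete_pair V Y ->
  exists (D C : lmodType L) (i : {linear Z q -> D}) (p : {linear D -> C}),
    [/\ MUV C, NXY D & short_exact i p].
Proof.
move=> tor eM cU cV; have cot := cotorsion_pair_MN tor eM.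
have [_ [DY [CY [i [p [hCY hDY exY]]]]]] := cV (qY q).
have [E1 [h1 [g1 [hg1 [j1 [r1 [ab1 ab1' exE1]]]]]]] :=
  quad_pushout hNM exY (Tor1_eq0_inj (tor _ hCY) exY).
set e1 := mkquad hNM hg1 in ab1 ab1'.
have ex1 : short_exact (quad_lin ab1) (quad_lin ab1') by exact/quad_short_exact.
pose P := cover (homMod M (qY e1)); pose pi : {linear P -> _} := cover_map _.
have [hg2 [ab2 ab2']] := quad_add hNM pi.
set e2 := mkquad hNM hg2 in ab2 ab2'.
have ex2 : short_exact (quad_lin ab2) (quad_lin ab2').
  by apply/quad_short_exact; split; [exact: pair_short_exact|exact: id_short_exact].
have s2 : surj (qh e2).
  move=> k; have [u uE] := @cover_map_surj _ _ k; exists (0, u).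
  by rewrite qh_mkquad /= linear0 add0r.
have [_ [DX [CX [a [b [hCX hDX exX]]]]]] := cU (ker (qh e2)).
have [E3 [h3 [g3 [hg3 [j3 [r3 [l3 [[ab3 ab3' exE3] [hl il hj rl]]]]]]]]] :=
  quad_pushout_ker hNM exX.
set e3 := mkquad hNM hg3 in ab3 ab3'.
have ex3 : short_exact (quad_lin ab3) (quad_lin ab3').
  by apply/quad_short_exact; split=> //; exact: id_short_exact.
have hP : U P by exact/(cotorsion_projective hUX)/free_mod_projective.
(* The cokernel of the total embedding is filtered by (N ⊗ CY, CY), (P, 0) and (CX, 0), all in
   [MUV]. *)
have [C4 [p4 [hC4 ex4]]] := cotorsion_left_compose cot ex1 ex2
  (classM_indB eM hCY) (classM_inflA eM hP).
have [C5 [p5 [hC5 ex5]]] := cotorsion_left_compose cot ex4 ex3 hC4 (classM_inflA eM hCX).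
exists (Z e3), C5, (comp_lin (quad_lin ab3) (comp_lin (quad_lin ab2) (quad_lin ab1))), p5.
split; [exact: hC5| |exact: ex5].
exists e3; last exact: iso_refl; split=> //; last first.
  move=> k; have [x xE] := s2 k; exists (j3 x).
  by rewrite -[LHS]/(qh e3 (j3 x)) qh_mkquad hj.
(* By construction of the last pushout, [l3] identifies [DX] with the kernel of the final h. *)
apply: (cotorsion_right_iso hUX) hDX.
have [v|k kE] := factor_inj (h := l3) (@ker_lin_inj _ _ _ (qh e3)).
  by apply/ker_linP; rewrite qh_mkquad; apply/hl; exists v.
exists k; apply: bij_of => [x y e|y]; first by apply: il; rewrite -!kE e.
have := ker_linK y; rewrite qh_mkquad => /hl[v vE].
by exists v; apply: ker_lin_inj; rewrite kE.
Qed.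

Lemma complete_pair_MN : TorNV -> ExtMY -> complete_pair U X -> complete_pair V Y ->
  complete_pair MUV NXY.
Proof.
move=> tor eM cU cV; have cot := cotorsion_pair_MN tor eM.
apply: (complete_of_right cot) => W; have [q [h bh]] := quad_exists W.
have [D [C [i [p [hC hD ex]]]]] := classN_envelope q tor eM cU cV.
exists D, C, (comp_lin i h), p; split=> //.
have bid : bijective (id_lin C) by exists id.
have [i1 ip1 sp1] := short_exact_iso bh bid ex.
by split.
Qed.

(** Vanishing of Tor on the lower quotient keeps N ⊗ - exact on the lower row. The three maps g are
    then injective, and the snake lemma gives a short exact sequence of their cokernels; heredity of
    the given pairs applies to it and to the lower row. *)
Lemma classM_ker (W W' : lmodType L) (p : {linear W -> W'}) : TorNV ->
  hereditary_pair U X -> hereditary_pair V Y -> MUV W -> MUV W' -> surj p -> MUV (ker p).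
Proof.
move=> tor hU hV [q1 [hU1 hV1 ig1] iW] [q2 [hU2 hV2 ig2] iW'] sp.
have [q0 i0] := quad_exists (ker p).
have [h0 bh0] := iso_sym i0; have [h2 bh2] := iW'; have [h1 bh1] := iW.
have [h1' [h1K h1'K]] := bij_lin_inv bh1.
have ex := short_exact_mid h1K h1'K (short_exact_iso bh0 bh2 (short_exact_ker sp)).
have [a [b [a' [b' [[[ab1 ab2] [ab1' ab2']] ea eb _ _]]]]] := quad_short_exact_inv ex.
have iN := Tor1_eq0_inj (tor _ hV2) eb.
exists q0 => //.
have ig0 : injective (qg q0).
  apply: ker_inj => t gt0; apply: (inj_ker iN); apply: (inj_ker ig1).
  by rewrite -ab2 gt0 linear0.
split=> //; last exact: (hereditary_left_exact hVY hV eb).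
have [ia aa' sa'] := ea; have [ib bb' sb'] := eb.
have [x|i iE] := factor_surj (h := comp_lin (coker_lin (qg q1)) a) (@coker_lin_surj _ _ _ (qg q0)).
  by move=> /coker_linP[t <-]; rewrite comp_linE ab2; apply/coker_linP; exists (tensor_map N b t).
have [x|r rE] := factor_surj (h := comp_lin (coker_lin (qg q2)) a') (@coker_lin_surj _ _ _ (qg q1)).
  by move=> /coker_linP[t <-]; rewrite comp_linE ab2'; apply/coker_linP; exists (tensor_map N b' t).
apply: (hereditary_left_exact hUX hU (i := i) (p := r)) => //; split=> [|y|y].
- apply: ker_inj => y; have [x <-] := coker_lin_surj y.
  rewrite iE comp_linE => /coker_linP[t tE].
  (* Injectivity of g on the quotient forces t to vanish in its tensor product, so t comes from the
     kernel's; this is injectivity on cokernels. *)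
  have /(tensor_right_exact bb' sb')[t0 t0E] : tensor_map N b' t = 0.
    by apply: (inj_ker ig2); rewrite -ab2' tE (short_exact_comp0 _ ea).
  by apply/coker_linP; exists t0; apply: ia; rewrite ab2 t0E.
- have [x <-] := coker_lin_surj y; rewrite rE comp_linE.
  split=> [/coker_linP[t tE]|[z]].
    have [t1 t1E] := tensor_map_surj (N := N) sb' t.
    have /aa'[w wE] : a' (x - qg q1 t1) = 0 by rewrite linearB ab2' t1E tE subrr.
    exists (coker_lin _ w); rewrite iE comp_linE wE linearB.
    have /coker_linP -> : exists t', qg q1 t' = qg q1 t1 by exists t1.
    exact: subr0.
  have [w <-] := coker_lin_surj z; rewrite iE comp_linE -[coker_lin _ (a' x)]rE => <-.
  by rewrite rE comp_linE (short_exact_comp0 _ ea) linear0.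
- have [x <-] := coker_lin_surj y; have [z <-] := sa' x.
  by exists (coker_lin _ z); rewrite rE.
Qed.

End Assembly.

Theorem corollary4p9 (A B : pzRingType) (M : bimodType B A) (N : bimodType A B)
    (c : morita_context M N)
    (U X : mod_class A) (V Y : mod_class B)
    (hUX : cotorsion_pair U X) (hVY : cotorsion_pair V Y)
    (hNM : forall t : tensor N M, t = 0) :
  let MUV := classM c U V in
  let NXY := classN c X Y in
  let TorNV := forall W : lmodType B, V W -> Tor1_eq0 N W in
  let ExtMY := forall W : lmodType B, Y W -> Ext1_eq0 M W in
  [/\ TorNV -> cotorsion_pair (lperp NXY) NXY,
      ExtMY -> cotorsion_pair MUV (rperp MUV)
    & TorNV -> ExtMY ->
        cotorsion_pair MUV NXY /\
        ((complete_pair U X /\ hereditary_pair U X) /\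
         (complete_pair V Y /\ hereditary_pair V Y) ->
         complete_pair MUV NXY /\ hereditary_pair MUV NXY)].
Proof.
move=> MUV NXY TorNV ExtMY; split.
- exact: (cotorsion_pair_classN c hNM hUX hVY).
- exact: (cotorsion_pair_classM c hNM hUX hVY).
- move=> tor eM; have cot := cotorsion_pair_MN c hNM hUX hVY tor eM.
  split=> // -[[cU hU] [cV hV]]; split.
    exact: (complete_pair_MN hNM hUX hVY tor eM cU cV).
  apply: (hereditary_of_left cot) => W W' p hW hW' sp.
  exact: (classM_ker hUX hVY tor hU hV hW hW' sp).
Qed.
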